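(* Let $1 < p,q<\infty$ be such that $1/p+1/q\geq 1$. Let $X$ be a Banach space with a countable unconditional finite-dimensional Schauder decomposition having a disjoint lower $p$-estimate, and let $Y$ be a Banach space with a countable unconditional finite-dimensional Schauder decomposition having a disjoint lower $q$-estimate. If $X$ and $Y$ are strongly weakly compactly generated (SWCG), then the projective tensor product $X \widehat{\otimes}_\pi Y$ is SWCG.
   Context: By a subspace of a Banach space we mean a norm closed linear subspace. $B_X$ denotes the closed unit ball of $X$. A Banach space $X$ is strongly weakly compactly generated (SWCG) if there is a weakly compact set $G \subseteq X$ such that for every weakly compact set $K \subseteq X$ and every $\varepsilon>0$ there is $n\in \mathbb{N}$ such that $K \subseteq nG + \varepsilon B_X$. An unconditional Schauder decomposition of a Banach space $X$ is a family $\{X_i\}_{i\in I}$ of subspaces of $X$ such that each $x\in X$ can be written in a unique way as $x=\sum_{i\in I} x_i$ with $x_i\in X_i$ for all $i\in I$ and the series unconditionally convergent. For each $i \in I$ there is the associated bounded projection $P_i$ from $X$ onto $X_i$, so that $x=\sum_{i\in I}P_i(x)$ for all $x \in X$; for $C\subseteq I$, $P_C(x):=\sum_{i\in C}P_i(x)$ defines a bounded projection. The decomposition is finite-dimensional if each $X_i$ is finite-dimensional, and countable if $I$ is countable. For $1<p<\infty$, an unconditional Schauder decomposition $\{X_i\}_{i\in I}$ of $X$ has a disjoint lower $p$-estimate if there is a constant $c>0$ such that, for every finite collection $C_1,\dots,C_r$ of pairwise disjoint finite subsets of $I$ and every $x\in X$, $\left(\sum_{k=1}^r \|P_{C_k}(x)\|^p\right)^{1/p}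 \leq c \|x\|$. $X\widehat{\otimes}_\pi Y$ denotes the projective tensor product of the Banach spaces $X$ and $Y$ (the completion of $X \otimes Y$ under the projective norm). *)

(* Defs.v *)
From HB Require Import structures.
From mathcomp Require Import all_boot all_order all_algebra finmap.
From mathcomp Require Import complex.
From mathcomp Require Import all_classical all_reals all_analysis.
From mathcomp.analysis.showcase Require summability.

Set Implicit Arguments.
Unset Strict Implicit.
Unset Printing Implicit Defensive.

Import Order.TTheory GRing.Theory Num.Theory.
Import numFieldNormedType.Exports.

Local Open Scope classical_set_scope.
Local Open Scope ring_scope.

(* Banach spaces may be real or complex: both cases are covered by one
   parameter [k].  The norm of a [normedModType K] takes its values in [K];
   [rnorm] is the same number, seen in [R]. *)
Variant scalar_kind := RealScalars | ComplexScalars.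

Definition scalars (R : realType) (k : scalar_kind) : numFieldType :=
  match k with
  | RealScalars => R : numFieldType
  | ComplexScalars => R[i] : numFieldType
  end.

Definition scalar_re (R : realType) (k : scalar_kind) : scalars R k -> R :=
  match k return scalars R k -> R with
  | RealScalars => fun a => a
  | ComplexScalars => @complex.Re R
  end.

Definition rnorm (R : realType) (k : scalar_kind)
  (X : normedModType (scalars R k)) (x : X) : R := scalar_re `|x|.

Section WeakTopology.
Variables (K : numFieldType) (X : normedModType K).

Definition dual : Type := {f : {linear X -> K^o} | continuous f}.

HB.instance Definition _ := gen_eqMixin dual.
HB.instance Definition _ := gen_choiceMixin dual.

Definition dual_eval (x : X) : {ptws dual -> K^o} := fun f => sval f x.

Definition weakly_compact (A : set X) : Prop :=
  @compact (initial_topology dual_eval) A.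

(* strongly weakly compactly generated *)
Definition swcg : Prop :=
  exists2 G : set X, weakly_compact G &
    forall H : set X, weakly_compact H -> forall eps : K, 0 < eps ->
      exists n : nat,
        H `<=` [set n%:R *: g + eps *: b | g in G & b in [set b : X | `|b| <= 1]].

End WeakTopology.
Arguments swcg {K} X.

Section SchauderDecomposition.
Variables (K : numFieldType) (X : normedModType K).

Definition is_subspace (E : set X) : Prop :=
  [/\ closed E, E 0 & forall (a : K) (x y : X), E x -> E y -> E (a *: x + y)].

Definition finite_dimensional (E : set X) : Prop :=
  exists (n : nat) (e : 'I_n -> X),
    E = [set x | exists a : 'I_n -> K, x = \sum_i a i *: e i].

Variable I : choiceType.

(* convergence of the net of the partial sums over the finite subsets of I *)
Definition unconditional_sum (f : I -> X) (x : X) : Prop :=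
  summability.partial_sum f @ summability.totally --> x.

Definition decomposes (D : I -> set X) (x : X) (f : I -> X) : Prop :=
  (forall i, D i (f i)) /\ unconditional_sum f x.

Definition unconditional_schauder_decomposition (D : I -> set X) : Prop :=
  (forall i, is_subspace (D i)) /\
  (forall x : X, exists! f : I -> X, decomposes D x f).

(* P_i, meaningful when D is an unconditional Schauder decomposition *)
Definition schauder_proj (D : I -> set X) (i : I) (x : X) : X :=
  xget (fun=> 0) (decomposes D x) i.

Definition schauder_fproj (D : I -> set X) (C : {fset I}) (x : X) : X :=
  \sum_(i <- C) schauder_proj D i x.

End SchauderDecomposition.

Definition disjoint_lower_estimate (R : realType) (k : scalar_kind)
    (X : normedModType (scalars R k)) (I : choiceType) (D : I -> set X)
    (p : R) : Prop :=
  exists2 c : R, 0 < c &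
    forall (r : nat) (C : 'I_r -> {fset I}),
      (forall j l, j != l -> [disjoint C j & C l]%fset) ->
      forall x : X,
        (\sum_(j < r) rnorm (schauder_fproj D (C j) x) `^ p) `^ p^-1
          <= c * rnorm x.

Section ProjectiveTensorProduct.
Variables (R : realType) (k : scalar_kind).
Let K := scalars R k.

Definition tensor_sum (X Y V : lmodType K) (b : {bilinear X -> Y -> V})
  (s : seq (X * Y)) : V := \sum_(u <- s) b u.1 u.2.

(* The Banach space Z, with t : (x, y) |-> x (x) y, is the completion of the
   algebraic tensor product of X and Y under the projective norm:
   - [ptp_algebraic]: the span of the t x y is the algebraic tensor product,
     i.e. every bilinear map factors linearly through it;
   - [ptp_norm]: on this span, the norm of Z is the projective norm;
   - [ptp_dense]: this span is dense in the complete space Z.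
   This determines (Z, t) up to a unique isometric isomorphism. *)
Record is_projective_tensor_product (X Y Z : completeNormedModType K)
    (t : {bilinear X -> Y -> Z}) : Prop := {
  ptp_algebraic : forall (V : lmodType K) (b : {bilinear X -> Y -> V})
    (s : seq (X * Y)), tensor_sum t s = 0 -> tensor_sum b s = 0;
  ptp_norm : forall s : seq (X * Y),
    rnorm (tensor_sum t s) =
      inf [set \sum_(u <- s') rnorm u.1 * rnorm u.2
          | s' in [set s' | tensor_sum t s' = tensor_sum t s]];
  ptp_dense : dense (range (tensor_sum t)) }.

End ProjectiveTensorProduct.

(* Main.v *)
Require Import Defs.
From HB Require Import structures.
From mathcomp Require Import all_boot all_order all_algebra.
From mathcomp Require Import all_classical all_reals all_analysis.
From mathcomp Require Import finmap complex ring lra.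
From mathcomp.analysis.showcase Require summability.
Import Order.TTheory GRing.Theory Num.Theory.
Import numFieldNormedType.Exports.
Local Open Scope classical_set_scope.
Local Open Scope ring_scope.

Set Implicit Arguments.
Unset Strict Implicit.
Unset Printing Implicit Defensive.

(** Enumerate both decompositions, and let P_n and Q_n be the projections of X and
    Y on the first n coordinates.

    The heart of the proof is that, for every weakly compact subset A of the
    projective tensor product Z, the norm of ((1 - P_n) (x) (1 - Q_n)) z tends to 0
    uniformly for z in A ([rest_uniformly_small]).  If this fails, there are
    elements z_j of A and consecutive blocks B_j of coordinates such that
    (P_(B_j) (x) Q_(B_j)) z_j stays away from 0.  Now, for all z, the sum of the
    norms of the diagonal blocks (P_(B_j) (x) Q_(B_j)) z is at most C times the norm
    of z: by definition of the projective norm it suffices to bound the sum of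
    the products of the norms of P_(B_j) x and Q_(B_j) y, and this is what the two
    lower estimates give when 1/p + 1/q >= 1 ([mul_le_powR],
    [diagonal_blocks_bound]).  Composing the j-th block with a functional that
    norms it at z_j sends A to a weakly compact subset of l1 whose j-th
    coordinates do not tend to 0 uniformly, which a gliding hump argument excludes
    ([summable_functionals_diagonal]).

    Consequently the identity of Z is, uniformly on each weakly compact set, a
    limit of the operators z |-> U_n z + V_n (z - U_n z), where U_n = P_n (x) 1 and
    V_n = 1 (x) Q_n.  As P_n has finite rank, U_n is a finite sum of maps
    Z -> Y -> Z, so the SWCG property of Y provides countably many weakly compact
    sets of Z that absorb, up to epsilon, the images under U_n of the weakly
    compact sets; likewise for V_n and X.  The operators with this property
    ([strongly_generated]) are stable under sums, under composition on the right
    and under the above kind of limits.  Hence the identity of Z has it, and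
    suitable multiples of the sets obtained, which are bounded
    ([weakly_compact_bounded]), have a weakly compact union that strongly
    generates Z ([swcg_strongly_generated]).

    Real and complex scalars are treated together by testing with real-linear
    functionals: they are the real parts of the scalar ones
    ([real_functional_re]), and they are what the Hahn-Banach theorem produces
    ([hahn_banach]). *)

(** * Scalars and real-valued norms *)

Section Scalars.
Variables (R : realType) (k : scalar_kind).
Local Notation K := (scalars R k).

Definition scalar_in (a : R) : K :=
  match k return scalars R k with
  | RealScalars => a
  | ComplexScalars => real_complex R a
  end.

Lemma scalar_in_monoid_morphism : monoid_morphism scalar_in.
Proof.
by rewrite /scalar_in; case: k => //; split=> [|x y]; rewrite ?rmorph1 ?rmorphM.
Qed.

Lemma scalar_in_zmod_morphism : zmod_morphism scalar_in.
Proof. by rewrite /scalar_in; case: k => // x y; rewrite rmorphB. Qed.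

HB.instance Definition _ :=
  GRing.isZmodMorphism.Build R K scalar_in scalar_in_zmod_morphism.
HB.instance Definition _ :=
  GRing.isMonoidMorphism.Build R K scalar_in scalar_in_monoid_morphism.

Lemma scalar_reK (a : R) : scalar_re (scalar_in a) = a.
Proof. by rewrite /scalar_in; case: k. Qed.

Lemma scalar_reD (y z : K) : scalar_re (y + z) = scalar_re y + scalar_re z.
Proof. by move: y z; case: k => //= -[a b] [c d]. Qed.

Lemma scalar_reM (a : R) (y : K) :
  scalar_re (scalar_in a * y) = a * scalar_re y.
Proof.
by move: y; rewrite /scalar_in; case: k => //= -[c d] /=; rewrite mul0r subr0.
Qed.

Lemma scalar_inK (y : K) : 0 <= y -> scalar_in (scalar_re y) = y.
Proof.
move: y; rewrite /scalar_in; case: k => //= -[a b] /=.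
by rewrite lecE /= => /andP[/eqP -> _].
Qed.

Lemma scalar_in_le (a b : R) : (scalar_in a <= scalar_in b) = (a <= b).
Proof. by rewrite /scalar_in; case: k => //; rewrite lecR. Qed.

Lemma scalar_in_lt (a b : R) : (scalar_in a < scalar_in b) = (a < b).
Proof. by rewrite /scalar_in; case: k => //; rewrite ltcR. Qed.

Lemma normr_scalar_in (a : R) : `|scalar_in a| = scalar_in `|a|.
Proof.
rewrite /scalar_in; case: k => //=.
by rewrite normc_def /= expr0n /= addr0 sqrtr_sqr.
Qed.

Lemma normr_scalar_re (y : K) : scalar_in `|scalar_re y| <= `|y|.
Proof. by move: y; rewrite /scalar_in; case: k => //= y; exact: normc_ge_Re. Qed.

Section Rnorm.
Variable X : normedModType K.
Implicit Types x y : X.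

Lemma normr_rnorm x : `|x| = scalar_in (rnorm x).
Proof. by rewrite /rnorm scalar_inK. Qed.

Lemma rnorm_ge0 x : 0 <= rnorm x.
Proof. by rewrite -scalar_in_le -normr_rnorm rmorph0. Qed.

Lemma rnorm0 : rnorm (0 : X) = 0.
Proof. by rewrite /rnorm normr0 -(rmorph0 scalar_in) scalar_reK. Qed.

Lemma rnormD x y : rnorm (x + y) <= rnorm x + rnorm y.
Proof. by rewrite -scalar_in_le rmorphD /= -!normr_rnorm ler_normD. Qed.

Lemma rnormN x : rnorm (- x) = rnorm x.
Proof. by rewrite /rnorm normrN. Qed.

Lemma rnormB x y : rnorm (x - y) <= rnorm x + rnorm y.
Proof. by rewrite -(rnormN y) rnormD. Qed.

Lemma rdistC x y : rnorm (x - y) = rnorm (y - x).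
Proof. by rewrite -rnormN opprB. Qed.

Lemma rnorm_eq0 x : rnorm x = 0 -> x = 0.
Proof. by move=> x0; apply/eqP; rewrite -normr_eq0 normr_rnorm x0 rmorph0. Qed.

Lemma rnorm_gt0 x : x != 0 -> 0 < rnorm x.
Proof.
by move=> x0; rewrite lt0r rnorm_ge0 andbT; apply: contra_neq x0 => /rnorm_eq0.
Qed.

Lemma rnorm_triangle x y z : rnorm (x - z) <= rnorm (x - y) + rnorm (y - z).
Proof. by apply: le_trans (rnormD _ _); rewrite addrA subrK. Qed.

Lemma rnorm_sum (T : Type) (r : seq T) (F : T -> X) :
  rnorm (\sum_(i <- r) F i) <= \sum_(i <- r) rnorm (F i).
Proof.
elim/big_rec2: _ => [|i u v _ uv]; first by rewrite rnorm0.
by rewrite (le_trans (rnormD _ _)) ?lerD2l.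
Qed.

End Rnorm.

(* The modulus of a scalar is its norm as a vector of K^o. *)
Lemma rnormZ (X : normedModType K) (a : K) (x : X) :
  rnorm (a *: x) = rnorm (a : K^o) * rnorm x.
Proof. by rewrite /rnorm normrZ -{1}(scalar_inK (normr_ge0 a)) scalar_reM. Qed.

Lemma rnorm_scalar_in (a : R) : rnorm (scalar_in a : K^o) = `|a|.
Proof. by rewrite /rnorm normr_scalar_in scalar_reK. Qed.

Lemma rnormZr (X : normedModType K) (a : R) (x : X) :
  rnorm (scalar_in a *: x) = `|a| * rnorm x.
Proof. by rewrite rnormZ rnorm_scalar_in. Qed.

Lemma ler_scalar_re (y : K) : `|scalar_re y| <= rnorm (y : K^o).
Proof. by rewrite -scalar_in_le -normr_rnorm normr_scalar_re. Qed.

Lemma cvg_rnormP (X : normedModType K) (T : Type) (F : set_system T)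
    {FF : Filter F} (f : T -> X) (x : X) :
  f @ F --> x <-> forall e : R, 0 < e -> \forall t \near F, rnorm (x - f t) < e.
Proof.
split=> [/cvgrPdist_lt fx e e0|fx].
  have /fx : 0 < scalar_in e by rewrite -(rmorph0 scalar_in) scalar_in_lt.
  by apply: filterS => t; rewrite normr_rnorm scalar_in_lt.
apply/cvgrPdist_lt => e e0; rewrite -(scalar_inK (ltW e0)).
have /fx : 0 < scalar_re e.
  by rewrite -scalar_in_lt scalar_inK ?rmorph0 // ltW.
by apply: filterS => t; rewrite normr_rnorm scalar_in_lt.
Qed.

End Scalars.
Arguments scalar_in {R k}.

(** * The Hahn-Banach theorem *)

Section HahnBanach.
Variables (R : realType) (k : scalar_kind).
Local Notation K := (scalars R k).
Variable X : lmodType K.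
Implicit Types (f p q : X -> R) (x y : X).

Definition real_linear f :=
  (forall x y, f (x + y) = f x + f y) /\
  (forall a x, f (scalar_in a *: x) = a * f x).

Definition sublinear q :=
  (forall x y, q (x + y) <= q x + q y) /\
  (forall a x, 0 <= a -> q (scalar_in a *: x) = a * q x).

Lemma real_linearN f : real_linear f -> forall x, f (- x) = - f x.
Proof.
by case=> _ fZ x; rewrite -scaleN1r -(rmorph1 scalar_in) -rmorphN fZ mulN1r.
Qed.

Lemma real_linearB f : real_linear f -> forall x y, f (x - y) = f x - f y.
Proof. by move=> fl x y; rewrite fl.1 real_linearN. Qed.

Lemma sublinear0 q : sublinear q -> q 0 = 0.
Proof. by case=> _ qZ; rewrite -(scale0r 0) -(rmorph0 scalar_in) qZ // mul0r. Qed.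

Lemma sublinear_opp q x : sublinear q -> - q (- x) <= q x.
Proof.
by move=> ql; have := ql.1 x (- x); rewrite subrr (sublinear0 ql) -lerBlDr sub0r.
Qed.

Lemma sublinear_le q : q 0 = 0 -> (forall x y, q (x + y) <= q x + q y) ->
  (forall a x, 0 < a -> q (scalar_in a *: x) <= a * q x) -> sublinear q.
Proof.
move=> q0 qD qZ; split=> // a x; rewrite le_eqVlt => /predU1P[<-|a0].
  by rewrite rmorph0 scale0r q0 mul0r.
apply/eqP; rewrite eq_le qZ //= -ler_pdivlMl //.
rewrite -{1}(scale1r x) -(rmorph1 scalar_in) -(mulVf (lt0r_neq0 a0)).
by rewrite rmorphM -scalerA qZ // invr_gt0.
Qed.

Lemma le_infD (I J : Type) (A : set I) (B : set J) (u : I -> R) (v : J -> R) m :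
  A !=set0 -> B !=set0 -> (forall i j, A i -> B j -> m <= u i + v j) ->
  m <= inf [set u i | i in A] + inf [set v j | j in B].
Proof.
move=> [i0 Ai0] [j0 Bj0] muv; rewrite -lerBlDr; apply: lb_le_inf.
  by exists (u i0), i0.
move=> _ [i Ai <-]; rewrite lerBlDr addrC -lerBlDr; apply: lb_le_inf.
  by exists (v j0), j0.
by move=> _ [j Bj <-]; rewrite lerBlDr addrC muv.
Qed.

Lemma inf_le (I : Type) (A : set I) (u : I -> R) m i :
  (forall j, A j -> m <= u j) -> A i -> inf [set u i | i in A] <= u i.
Proof.
move=> mu Ai; apply: ge_inf; last by exists i.
by exists m => _ [j Aj <-]; exact: mu.
Qed.

Lemma le_inf_set (I : Type) (A : set I) (u : I -> R) m i0 :
  A i0 -> (forall j, A j -> m <= u j) -> m <= inf [set u i | i in A].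
Proof.
move=> Ai0 mu; apply: lb_le_inf; first by exists (u i0), i0.
by move=> _ [j Aj <-]; exact: mu.
Qed.

(** A sublinear minorant of [q] whose value at [- y] is at most [- q y].  A
    minimal sublinear [q] must coincide with all its slopes, and this makes it
    additive. *)
Definition slope q y x : R :=
  inf [set q (x + scalar_in t *: y) - t * q y | t in [set t | 0 <= t]].

Lemma slope_bounded q y x t : sublinear q -> 0 <= t ->
  - q (- x) <= q (x + scalar_in t *: y) - t * q y.
Proof.
move=> ql t0; rewrite lerBrDr addrC -lerBrDr opprK -ql.2 //.
by apply: le_trans (ql.1 _ _); rewrite addrC addKr.
Qed.

Lemma slope_le q y x t : sublinear q -> 0 <= t ->
  slope q y x <= q (x + scalar_in t *: y) - t * q y.
Proof.
move=> ql; apply: (@inf_le _ _ (fun t => q (x + scalar_in t *: y) - t * q y)).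
by move=> s; exact: slope_bounded.
Qed.

Lemma slope_sublinear q y : sublinear q -> sublinear (slope q y).
Proof.
move=> ql; apply: sublinear_le => [|x z|a x a0].
- apply/eqP; rewrite eq_le; apply/andP; split.
    have := slope_le y 0 ql (lexx 0).
    by rewrite rmorph0 scale0r mul0r subr0 addr0 (sublinear0 ql).
  apply: (@le_inf_set _ _ _ _ 0) => //= t t0.
  by rewrite add0r ql.2 // subrr.
- apply: le_infD; [by exists 0 => /=|by exists 0 => /=|move=> s t /= s0 t0].
  have := slope_le y (x + z) ql (addr_ge0 s0 t0).
  move=> /le_trans; apply.
  rewrite addrACA -opprD -mulrDl lerB // rmorphD /= scalerDl addrACA.
  exact: ql.1.
- rewrite mulrC -ler_pdivrMr //; apply: (@le_inf_set _ _ _ _ 0) => //= t t0.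
  rewrite ler_pdivrMr // mulrC.
  have at0 : 0 <= a * t by rewrite mulr_ge0 // ltW.
  apply: le_trans (slope_le y _ ql at0) _.
  by rewrite rmorphM -scalerA -scalerDr ql.2 ?(ltW a0)// mulrBr mulrA.
Qed.

(** Zorn's lemma applies because the infimum of a chain of sublinear minorants
    of [p] is again one: it is finite, being bounded below by [- p (- x)]. *)
Lemma minimal_sublinear p : sublinear p -> exists2 q,
  sublinear q /\ (forall x, q x <= p x) &
  forall q', sublinear q' -> (forall x, q' x <= q x) -> q' = q.
Proof.
move=> pl; pose T := {q | sublinear q /\ forall x, q x <= p x}.
pose below (s t : T) := `[< forall x, sval t x <= sval s x >].
have [||[s Ps] [t Pt]|A Atot|[q [ql qp]] qmin] := @Zorn T below.
- by move=> s; apply/asboolP.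
- by move=> r s t /asboolP rs /asboolP st; apply/asboolP => x; exact: le_trans (rs x).
- move=> /asboolP st /asboolP ts; apply: eq_exist; apply/funext => x.
  by apply/eqP; rewrite eq_le st ts.
- have [->|/set0P[s0 As0]] := eqVneq A set0.
    by exists (exist _ p (conj pl (fun x => lexx _))).
  pose m x := inf [set sval s x | s in A].
  have slow s x : A s -> - p (- x) <= sval s x.
    move=> _; have [sl sp] := svalP s.
    by apply: le_trans (sublinear_opp x sl); rewrite lerN2.
  have mle s x : A s -> m x <= sval s x.
    by move=> As; apply: (inf_le (m := - p (- x))) => // j; exact: slow.
  have ml : sublinear m.
    apply: sublinear_le => [|x y|a x a0].
    + apply/eqP; rewrite eq_le; apply/andP; split.
        by apply: le_trans (mle _ _ As0) _; rewrite (sublinear0 (svalP s0).1).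
      by apply: (le_inf_set As0) => s As; rewrite (sublinear0 (svalP s).1).
    + apply: le_infD; [by exists s0|by exists s0|move=> s t As At].
      have [/asboolP st|/asboolP ts] := Atot _ _ As At.
        apply: le_trans (mle t _ At) _; apply: le_trans ((svalP t).1.1 _ _) _.
        by rewrite lerD2r.
      apply: le_trans (mle s _ As) _; apply: le_trans ((svalP s).1.1 _ _) _.
      by rewrite lerD2l.
    + rewrite mulrC -ler_pdivrMr //; apply: (le_inf_set As0) => s As.
      rewrite ler_pdivrMr // mulrC -((svalP s).1.2 _ _ (ltW a0)); exact: mle.
  have mp x : m x <= p x by apply: le_trans (mle _ _ As0) _; exact: (svalP s0).2.
  by exists (exist _ m (conj ml mp)) => s As; apply/asboolP => x /=; exact: mle.
- exists q => // q' ql' q'q.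
  have q'p x : q' x <= p x by exact: le_trans (q'q x) (qp x).
  have := qmin (exist _ q' (conj ql' q'p)).
  by move=> /(_ _)/(congr1 sval); apply; apply/asboolP.
Qed.

(** A minimal sublinear minorant is linear.  Taking it below the slope of [p]
    in the direction [x0], rather than below [p], forces the value [p x0] at
    [x0]. *)
Lemma hahn_banach p x0 : sublinear p ->
  exists f, [/\ real_linear f, forall x, f x <= p x & f x0 = p x0].
Proof.
move=> pl.
have slopep q y x : sublinear q -> slope q y x <= q x.
  move=> ql; have := slope_le y x ql (lexx 0).
  by rewrite rmorph0 scale0r mul0r subr0 addr0.
have [f [fl fp] fmin] := minimal_sublinear (slope_sublinear x0 pl).
have fle x : f x <= p x by apply: le_trans (fp x) (slopep _ _ _ pl).
have fD x y : f (x + y) = f x + f y.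
  apply/eqP; rewrite eq_le fl.1 /=.
  rewrite -lerBrDr -{1}(fmin _ (slope_sublinear y fl) (fun z => slopep f y z fl)).
  by have := slope_le y x fl ler01; rewrite rmorph1 scale1r mul1r.
have fN x : f (- x) = - f x.
  by apply/eqP; rewrite -addr_eq0 addrC -fD subrr (sublinear0 fl).
exists f; split=> //.
  split=> // a x; have [a0|a0] := leP 0 a; first exact: fl.2.
  by rewrite -[a]opprK rmorphN scaleNr fN fl.2 ?mulNr// oppr_ge0 ltW.
apply/eqP; rewrite eq_le fle /= -[f x0]opprK -fN lerNr.
apply: le_trans (fp _) _; have := slope_le x0 (- x0) pl ler01.
by rewrite rmorph1 scale1r addNr (sublinear0 pl) mul1r sub0r.
Qed.

End HahnBanach.

(** * Bounded operators and functionals *)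

Section Functionals.
Variables (R : realType) (k : scalar_kind).
Local Notation K := (scalars R k).

Definition bounded_linear (X Y : normedModType K) (f : X -> Y) :=
  linear f /\ exists C : R, forall x, rnorm (f x) <= C * rnorm x.

Definition real_functional (X : normedModType K) (r : X -> R) :=
  real_linear r /\ exists C : R, forall x, `|r x| <= C * rnorm x.

Section BoundedLinear.
Variables X Y : normedModType K.
Implicit Types f g : X -> Y.

Lemma bounded_linearP f : bounded_linear f ->
  exists2 C : R, 0 < C & forall x, rnorm (f x) <= C * rnorm x.
Proof.
move=> [_ [C fC]]; exists (Num.max C 1); first by rewrite lt_max ltr01 orbT.
by move=> x; rewrite (le_trans (fC x))// ler_wpM2r ?rnorm_ge0// le_max lexx.
Qed.

Lemma bounded_linearE f : bounded_linear f ->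
  exists g : {linear X -> Y}, f = g.
Proof.
move=> [fl _]; pose gM := GRing.isLinear.Build _ _ _ _ f fl.
pose g : {linear X -> Y} := HB.pack f gM.
by exists g.
Qed.

Lemma bounded_linearD f : bounded_linear f -> {morph f : x y / x + y}.
Proof. by move=> /bounded_linearE[g ->] x y; rewrite linearD. Qed.

Lemma bounded_linearB f : bounded_linear f -> {morph f : x y / x - y}.
Proof. by move=> /bounded_linearE[g ->] x y; rewrite linearB. Qed.

Lemma bounded_linearZ f : bounded_linear f -> scalable f.
Proof. by move=> /bounded_linearE[g ->] a x; rewrite linearZ. Qed.

Lemma bounded_linear0 f : bounded_linear f -> f 0 = 0.
Proof. by move=> /bounded_linearE[g ->]; rewrite linear0. Qed.

Lemma bounded_linear_sum f (T : Type) (s : seq T) (F : T -> X) :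
  bounded_linear f -> f (\sum_(i <- s) F i) = \sum_(i <- s) f (F i).
Proof. by move=> /bounded_linearE[g ->]; rewrite linear_sum. Qed.

Lemma bounded_linear_cst0 : bounded_linear (fun _ : X => 0 : Y).
Proof.
split=> [a x y|]; first by rewrite scaler0 addr0.
by exists 0 => x; rewrite rnorm0 mul0r.
Qed.

Lemma bounded_linear_add f g : bounded_linear f -> bounded_linear g ->
  bounded_linear (fun x => f x + g x).
Proof.
move=> fb gb; split.
  by move=> a x y; rewrite fb.1 gb.1 scalerDr addrACA.
have [[C _ fC] [D _ gD]] := (bounded_linearP fb, bounded_linearP gb).
by exists (C + D) => x; rewrite mulrDl (le_trans (rnormD _ _))// lerD.
Qed.

Lemma bounded_linear_scale (c : K) f : bounded_linear f ->
  bounded_linear (fun x => c *: f x).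
Proof.
move=> fb; split.
  by move=> a x y; rewrite fb.1 scalerDr !scalerA mulrC.
have [C _ fC] := bounded_linearP fb; exists (rnorm (c : K^o) * C) => x.
by rewrite rnormZ -mulrA ler_wpM2l ?rnorm_ge0.
Qed.

Lemma bounded_linear_opp f : bounded_linear f -> bounded_linear (fun x => - f x).
Proof.
move=> /(bounded_linear_scale (-1)).
by congr bounded_linear; apply/funext => x; rewrite scaleN1r.
Qed.

Lemma bounded_linear_sub f g : bounded_linear f -> bounded_linear g ->
  bounded_linear (fun x => f x - g x).
Proof. by move=> fb /bounded_linear_opp; exact: bounded_linear_add. Qed.

Lemma bounded_linear_bigsum (T : Type) (s : seq T) (F : T -> X -> Y) :
  (forall i, bounded_linear (F i)) ->
  bounded_linear (fun x => \sum_(i <- s) F i x).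
Proof.
move=> Fb; elim: s => [|i s IH].
  have := bounded_linear_cst0.
  by congr bounded_linear; apply/funext => x; rewrite big_nil.
have := bounded_linear_add (Fb i) IH.
by congr bounded_linear; apply/funext => x; rewrite big_cons.
Qed.

Lemma bounded_linear_cvg f (T : Type) (F : set_system T) {FF : Filter F}
    (u : T -> X) x :
  bounded_linear f -> u @ F --> x -> (f \o u) @ F --> f x.
Proof.
move=> fb; have [C C0 fC] := bounded_linearP fb.
move=> /(@cvg_rnormP _ _ _ _ _ FF) ux; apply/(@cvg_rnormP _ _ _ _ _ FF) => e e0.
have /ux : 0 < e / C by rewrite divr_gt0.
apply: filterS => t ut; rewrite /= -(bounded_linearB fb).
by apply: le_lt_trans (fC _) _; rewrite mulrC -ltr_pdivlMr.
Qed.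

Lemma bounded_linear_continuous f : bounded_linear f -> continuous f.
Proof. by move=> fb x; exact: (@bounded_linear_cvg f _ (nbhs x) _ id). Qed.

Lemma real_functionalP (r : X -> R) : real_functional r ->
  exists2 C : R, 0 < C & forall x, `|r x| <= C * rnorm x.
Proof.
move=> [_ [C fC]]; exists (Num.max C 1); first by rewrite lt_max ltr01 orbT.
by move=> x; rewrite (le_trans (fC x))// ler_wpM2r ?rnorm_ge0// le_max lexx.
Qed.

End BoundedLinear.

Lemma bounded_linear_id (X : normedModType K) : bounded_linear (@id X).
Proof. by split=> [a x y //|]; exists 1 => x; rewrite mul1r. Qed.

Lemma bounded_linear_comp (X Y Z : normedModType K) (f : Y -> Z) (g : X -> Y) :
  bounded_linear f -> bounded_linear g -> bounded_linear (fun x => f (g x)).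
Proof.
move=> fb gb; split; first by move=> a x y; rewrite gb.1 fb.1.
have [[C C0 fC] [D _ gD]] := (bounded_linearP fb, bounded_linearP gb).
exists (C * D) => x; apply: le_trans (fC _) _.
by rewrite -mulrA ler_wpM2l // ltW.
Qed.

Lemma bounded_linear_scaler (X Y : normedModType K) (l : X -> K^o) (y : Y) :
  bounded_linear l -> bounded_linear (fun x => l x *: y).
Proof.
move=> lb; split; first by move=> a u v; rewrite lb.1 scalerDl scalerA.
have [C _ lC] := bounded_linearP lb; exists (C * rnorm y) => x.
by rewrite rnormZ mulrAC ler_wpM2r ?rnorm_ge0.
Qed.

Lemma real_functional_comp (X Y : normedModType K) (r : Y -> R) (f : X -> Y) :
  real_functional r -> bounded_linear f -> real_functional (fun x => r (f x)).
Proof.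
move=> rb fb; split.
  split=> [x y|a x]; first by rewrite (bounded_linearD fb) rb.1.1.
  by rewrite (bounded_linearZ fb) rb.1.2.
have [[C C0 rC] [D _ fD]] := (real_functionalP rb, bounded_linearP fb).
exists (C * D) => x; apply: le_trans (rC _) _.
by rewrite -mulrA ler_wpM2l // ltW.
Qed.

(** The norm is sublinear, so the functional that it dominates and that agrees
    with it at [x] is a contraction. *)
Lemma norming_functional (X : normedModType K) (x : X) :
  exists r : X -> R,
    [/\ real_linear r, forall y, `|r y| <= rnorm y & r x = rnorm x].
Proof.
have nl : sublinear (@rnorm R k X).
  by split=> [y z|a y a0]; [exact: rnormD|rewrite rnormZr ger0_norm].
have [r [rl rn rx]] := hahn_banach x nl; exists r; split=> // y.
by rewrite ler_norml rn andbT lerNl -(real_linearN rl) -(rnormN y) rn.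
Qed.

End Functionals.

(** Over the complex numbers, [r] is the real part of the scalar functional
    [x |-> r x - i r (i x)]. *)
Lemma real_functional_re (R : realType) (k : scalar_kind)
    (X : normedModType (scalars R k)) (r : X -> R) : real_functional r ->
  exists2 f : X -> (scalars R k)^o, bounded_linear f &
    forall x, scalar_re (f x) = r x.
Proof.
case: k X r => X r [[rD rZ] [C rC]].
  exists r => //; split; first by move=> a x y; rewrite rD rZ.
  by exists C.
pose f x : R[i] := (r x +i* - r ('i%C *: x))%C.
exists f => //; split.
  move=> a x y.
  have rS z : r (a *: z) = complex.Re a * r z + complex.Im a * r ('i%C *: z).
    rewrite {1}(complexE a) scalerDl rD (mulrC 'i%C) -scalerA.
    by rewrite (rZ (complex.Re a)) (rZ (complex.Im a)).
  have rSi z : r ('i%C *: ('i%C *: z)) = - r z.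
    rewrite scalerA -expr2 sqr_i -[RHS]mulN1r -rZ.
    by rewrite rmorphN rmorph1.
  rewrite /f scalerDr !rD !scalerA (mulrC _ a) -scalerA !rS rSi.
  by apply/eqP; rewrite eq_complex /=; apply/andP; split; apply/eqP;
     case: (a) => u v /=; ring.
have normf (u v : R) : rnorm ((u +i* v)%C : (scalars R ComplexScalars)^o) <= `|u| + `|v|.
  rewrite /rnorm normc_def /= -[leRHS]ger0_norm ?addr_ge0// -sqrtr_sqr.
  rewrite ler_wsqrtr // sqrrD !real_normK ?num_real// lerD2r lerDl.
  by rewrite mulrn_wge0 // mulr_ge0.
exists (C + C) => x; apply: le_trans (normf _ _) _.
rewrite mulrDl normrN lerD // (le_trans (rC _))//.
have i1 : rnorm ('i%C : (scalars R ComplexScalars)^o) = 1.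
  by rewrite /rnorm normc_def /= expr0n /= expr1n add0r sqrtr1.
by rewrite (@rnormZ R ComplexScalars) i1 mul1r.
Qed.

(** * The weak topology *)

Section Weak.
Variables (R : realType) (k : scalar_kind).
Local Notation K := (scalars R k).
Local Notation weak X := (initial_topology (@dual_eval K X)).

Lemma dual_of (X : normedModType K) (f : X -> K^o) : bounded_linear f ->
  exists phi : dual X, forall x, sval phi x = f x.
Proof.
move=> fb; have [g fg] := bounded_linearE fb; rewrite fg.
have gc : continuous g by rewrite -fg; exact: bounded_linear_continuous.
by exists (exist _ g gc).
Qed.

Lemma weak_eval_continuous (X : normedModType K) (phi : dual X) :
  continuous (sval phi : weak X -> K^o).
Proof.
move=> x; apply: (@continuous_comp (weak X) {ptws dual X -> K^o} K^o
  (@dual_eval K X) (proj phi)); first exact: initial_continuous.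
exact: proj_continuous.
Qed.

Lemma weak_continuous (S : topologicalType) (X : normedModType K) (f : S -> X) :
  (forall phi : dual X, continuous (fun s => sval phi (f s))) ->
  continuous (f : S -> weak X).
Proof.
move=> fc; apply: continuous_comp_initial => s.
apply/cvg_sup => phi U.
have /= -> := @nbhsE (initial_topology (fun g : dual X -> K^o => g phi)).
case=> V [[B oB <-] Bfs] /filterS; apply.
by apply: (fc phi s); exact: open_nbhs_nbhs.
Qed.

Lemma scalar_re_continuous : continuous (@scalar_re R k : K^o -> R).
Proof.
move=> y; have FF := nbhs_filter (y : K^o).
apply/(@cvgrPdist_lt _ R^o _ _ FF) => e e0.
have e0' : 0 < scalar_in e :> K by rewrite -(rmorph0 scalar_in) scalar_in_lt.
have := @nbhsx_ballx K K^o y (scalar_in e) e0'.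
apply: filterS => z; rewrite -ball_normE /= => yz.
have {}yz : rnorm (y - z : K^o) < e by rewrite -(@scalar_in_lt R k) -normr_rnorm.
apply: le_lt_trans yz; apply: le_trans (ler_scalar_re _).
have scalar_reN (v : K) : scalar_re (- v) = - scalar_re v.
  by rewrite -mulN1r -(rmorph1 scalar_in) -rmorphN scalar_reM mulN1r.
by rewrite scalar_reD scalar_reN.
Qed.

Lemma real_functional_weak_continuous (X : normedModType K) (r : X -> R) :
  real_functional r -> continuous (r : weak X -> R).
Proof.
move=> /real_functional_re[f /dual_of[phi phif] fr] x.
have -> : r = @scalar_re R k \o sval phi by apply/funext => z /=; rewrite phif fr.
apply: (@continuous_comp (weak X) K^o R); first exact: weak_eval_continuous.
exact: scalar_re_continuous.
Qed.

Lemma norm_weak_continuous (X : normedModType K) : continuous (id : X -> weak X).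
Proof. by apply: weak_continuous => phi; exact: (svalP phi). Qed.

Lemma bounded_linear_weak_continuous (X Y : normedModType K) (f : X -> Y) :
  bounded_linear f -> continuous (f : weak X -> weak Y).
Proof.
move=> fb; apply: weak_continuous => phi.
have [g gf] := bounded_linearE fb.
have gc : continuous (sval phi \o g).
  move=> x; rewrite -gf; apply: continuous_comp; last exact: (svalP phi).
  exact: bounded_linear_continuous.
pose psi : dual X := exist _ (sval phi \o g : {linear X -> K^o}) gc.
by rewrite gf; exact: (@weak_eval_continuous X psi).
Qed.

Lemma addr_weak_continuous (X : normedModType K) :
  continuous ((fun z => z.1 + z.2) : weak X * weak X -> weak X).
Proof.
apply: weak_continuous => phi z.
under [X in continuous_at _ X]eq_fun do rewrite linearD.
apply: (@cvgD _ K^o).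
  apply: continuous_comp; [exact: cvg_fst|exact: weak_eval_continuous].
apply: continuous_comp; [exact: cvg_snd|exact: weak_eval_continuous].
Qed.

Lemma weakly_compact_image (X Y : normedModType K) (f : X -> Y) (A : set X) :
  bounded_linear f -> weakly_compact A -> weakly_compact (f @` A).
Proof.
move=> fb Ac; apply: (@continuous_compact (weak X) (weak Y) f A) => //.
by apply: continuous_subspaceT; exact: bounded_linear_weak_continuous.
Qed.

Lemma weakly_compact_add (X : normedModType K) (A B : set X) :
  weakly_compact A -> weakly_compact B ->
  weakly_compact [set a + b | a in A & b in B].
Proof.
move=> Ac Bc.
have -> : [set a + b | a in A & b in B] = (fun z => z.1 + z.2) @` (A `*` B).
  apply/seteqP; split=> [_ [a Aa [b Bb <-]]|_ [[a b] [/= Aa Bb] <-]].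
    by exists (a, b).
  by exists a => //; exists b.
apply: (@continuous_compact (weak X * weak X)%type (weak X)).
  by apply: continuous_subspaceT; exact: addr_weak_continuous.
exact: compact_setX.
Qed.

Lemma weakly_compact_set0 (X : normedModType K) : weakly_compact [set (0 : X)].
Proof. exact: (@compact_set1 (weak X)). Qed.

Lemma weakly_compact_seq_cluster (X : normedModType K) (A : set X) (u : nat -> X) :
  weakly_compact A -> (forall n, A (u n)) ->
  exists2 a, A a & forall (r : X -> R) (e : R) (N : nat),
    0 < e -> continuous (r : weak X -> R) ->
    exists2 n, (N <= n)%N & `|r (u n) - r a| < e.
Proof.
move=> Ac Au; have [|a [Aa ca]] := Ac (u @ \oo) _ _.
  by exists 0%N => //= n _; exact: Au.
exists a => // r e N e0 rc.
have /= Ur : nbhs (a : weak X) [set z | `|r z - r a| < e].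
  have /(@cvgrPdist_lt _ R^o) /(_ e e0) := rc a.
  by apply: filterS => z; rewrite distrC.
have [|x [[n /= Nn <-] rx]] := ca (u @` [set n | (N <= n)%N]) _ _ Ur.
  by exists N => //= n Nn; exists n.
by exists n.
Qed.

End Weak.

(** * Weakly compact sets: boundedness and unions *)

Section WeakCompactness.
Variables (R : realType) (k : scalar_kind).
Local Notation K := (scalars R k).
Local Notation weak X := (initial_topology (@dual_eval K X)).
Variable X : normedModType K.
Implicit Types (a : nat -> X -> R) (A : set X).

Lemma real_functional_series a (C : R) :
  (forall i, real_linear (a i)) ->
  (forall z n, \sum_(0 <= i < n) `|a i z| <= C * rnorm z) ->
  exists2 r : X -> R, real_functional r & forall z n e,
    (forall m, \sum_(n <= i < m) `|a i z| <= e) ->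
    `|r z - \sum_(0 <= i < n) a i z| <= e.
Proof.
move=> al aC; pose S z n : R := \sum_(0 <= i < n) a i z.
have Scvg z : cvgn (S z).
  apply: (@normed_cvg R R^o (a ^~ z)); apply: (@nondecreasing_is_cvgn R).
    apply/nondecreasing_seqP => n; by rewrite -subr_ge0 (seriesSB (fun i => `|a i z|)).
  by exists (C * rnorm z) => _ [n _ <-]; exact: aC.
pose r z := limn (S z).
have Sr z (e : R) : 0 < e -> exists N, forall m, (N <= m)%N -> `|r z - S z m| < e.
  move=> e0; have /(@cvgrPdist_lt _ R^o) /(_ e e0) := Scvg z.
  by case=> N _ NS; exists N => m Nm; exact: NS.
have rle z n e : (forall m, \sum_(n <= i < m) `|a i z| <= e) -> `|r z - S z n| <= e.
  move=> tail; apply/ler_addgt0Pr => d d0.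
  have [N /(_ (maxn N n) (leq_maxl _ _)) rS] := Sr z d d0.
  apply: le_trans (ler_distD (S z (maxn N n)) _ _) _.
  rewrite addrC lerD // ?(ltW rS)// /S.
  rewrite (@big_cat_nat _ _ _ n 0 (maxn N n))//= ?leq_maxr// addrAC subrr add0r.
  by apply: le_trans (ler_norm_sum _ _ _) (tail _).
have runiq z y : (forall e, 0 < e -> exists N, forall m, (N <= m)%N ->
    `|y - S z m| <= e) -> r z = y.
  move=> yS; apply/eqP; rewrite -subr_eq0 -normr_le0; apply/ler_addgt0Pr => e e0.
  have e2 : 0 < e / 2 by rewrite divr_gt0.
  have [[N rN] [M yM]] := (Sr z _ e2, yS _ e2).
  apply: le_trans (ler_distD (S z (maxn N M)) _ _) _.
  rewrite add0r (splitr e) lerD ?(ltW (rN _ (leq_maxl _ _)))//.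
  by rewrite distrC yM // leq_maxr.
exists r => //; split; last first.
  exists C => z; have := rle z 0 (C * rnorm z) (aC z).
  by rewrite /S big_geq // subr0.
split=> [x y|c x]; apply: runiq => e e0.
  have e2 : 0 < e / 2 by rewrite divr_gt0.
  have [[N xN] [M yM]] := (Sr x _ e2, Sr y _ e2).
  exists (maxn N M) => m; rewrite geq_max => /andP[Nm Mm].
  have -> : S (x + y) m = S x m + S y m.
    by rewrite /S -big_split; apply: eq_bigr => i _; rewrite (al i).1.
  rewrite opprD addrACA (le_trans (ler_normD _ _))// (splitr e).
  by rewrite lerD ?(ltW (xN _ Nm))// ?(ltW (yM _ Mm)).
have e2 : 0 < e / (`|c| + 1) by rewrite divr_gt0 // ltr_wpDl.
have [N xN] := Sr x _ e2; exists N => m Nm.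
have -> : S (scalar_in c *: x) m = c * S x m.
  by rewrite /S mulr_sumr; apply: eq_bigr => i _; rewrite (al i).2.
rewrite -mulrBr normrM.
have := ltW (xN _ Nm); rewrite ler_pdivlMr ?ltr_wpDl// mulrC.
by apply: le_trans; rewrite ler_wpM2r // lerDl.
Qed.

Lemma geometric_tail (n m : nat) :
  \sum_(n <= i < m) (3^-1 : R) ^+ i <= 3 / 2 * 3^-1 ^+ n.
Proof.
have [mn|/ltnW/subnKC <-] := leqP m n.
  by rewrite big_geq // mulr_ge0 // ?exprn_ge0 // divr_ge0.
have -> : \sum_(n <= i < n + (m - n)) (3^-1 : R) ^+ i =
    3 / 2 * (3^-1 ^+ n - 3^-1 ^+ (n + (m - n))).
  elim: (m - n)%N => [|d IH]; first by rewrite addn0 big_geq // subrr mulr0.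
  by rewrite addnS big_nat_recr ?leq_addr//= IH exprS; field.
by rewrite ler_wpM2l ?divr_ge0// gerBl exprn_ge0.
Qed.

(** Uniform boundedness by a gliding hump.  If [x n] in [A] has a norm of order
    at least [n 3 ^ n], add to the functional built so far the multiple
    [3 ^ (- n)] of a norming functional of [x n], with the sign of the value
    already taken at [x n].  The later terms undo at most half of it, so
    the sum is unbounded on [A], although it is weakly continuous. *)
Lemma weakly_compact_bounded A : weakly_compact A ->
  exists M : R, forall x, A x -> rnorm x <= M.
Proof.
move=> Ac; apply: contrapT => /forallNP unb.
have /choice[x xP] n : exists x, A x /\ 2 * n%:R * 3 ^+ n <= rnorm x.
  apply: contrapT => /forallNP small; apply: (unb (2 * n%:R * 3 ^+ n)) => x Ax.
  by rewrite leNgt; apply/negP => /ltW ?; apply: (small x).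
have /choice[r rP] n := norming_functional (x n).
have rl n : real_linear (r n) by case: (rP n).
pose psi := fix psi n : X -> R := if n is m.+1 then
  fun z => psi m z + (if 0 <= psi m (x m) then 1 else -1) * 3^-1 ^+ m * r m z
  else fun=> 0.
pose a n z := (if 0 <= psi n (x n) then 1 else -1) * 3^-1 ^+ n * r n z.
have psiE n z : psi n z = \sum_(0 <= i < n) a i z.
  by elim: n => [|n IH]; [rewrite big_geq|rewrite big_nat_recr //= IH].
have al i : real_linear (a i).
  split=> [y z|c z]; rewrite /a; first by rewrite (rl i).1 mulrDr.
  by rewrite (rl i).2 mulrCA.
have aN i z : `|a i z| <= 3^-1 ^+ i * rnorm z.
  rewrite /a !normrM (_ : `|if _ then _ else _| = 1) ?mul1r; last first.
    by case: ifP; rewrite ?normrN normr1.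
  rewrite ger0_norm ?exprn_ge0 // ler_wpM2l ?exprn_ge0 //.
  by case: (rP i).
have aT n m z : \sum_(n <= i < m) `|a i z| <= 3 / 2 * 3^-1 ^+ n * rnorm z.
  apply: le_trans (ler_sum _ (fun i _ => aN i z)) _.
  by rewrite -mulr_suml ler_wpM2r ?rnorm_ge0 ?geometric_tail.
have [|f fb fS] := real_functional_series (C := 3 / 2) al.
  by move=> z n; have := aT 0%N n z; rewrite expr0 mulr1.
have fx n : n%:R <= `|f (x n)|.
  have := fS (x n) n.+1 _ (fun m => aT n.+1 m (x n)).
  have psige : 3^-1 ^+ n * rnorm (x n) <= `|psi n.+1 (x n)|.
    have p0 : 0 <= 3^-1 ^+ n * rnorm (x n) by rewrite mulr_ge0 ?exprn_ge0 ?rnorm_ge0.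
    rewrite /=; have [_ _ ->] := rP n; case: ifPn => [s0|].
      by rewrite mul1r ger0_norm ?addr_ge0// lerDr.
    rewrite -ltNge => s0; rewrite mulN1r mulNr distrC.
    by rewrite ler_normr lerDl oppr_ge0 (ltW s0).
  rewrite -psiE => fpsi.
  have big : 2 * n%:R <= 3^-1 ^+ n * rnorm (x n).
    by rewrite exprVn [leRHS]mulrC ler_pdivlMr ?exprn_gt0//; case: (xP n).
  have tri : `|psi n.+1 (x n)| <= `|f (x n)| + `|f (x n) - psi n.+1 (x n)|.
    by rewrite -{1}(subKr (f (x n)) (psi n.+1 (x n))) ler_normB.
  (* The remainder beyond rank n is at most half of the term of rank n. *)
  have half : 3 / 2 * 3^-1 ^+ n.+1 * rnorm (x n) = (3^-1 ^+ n * rnorm (x n)) / 2.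
    by rewrite exprS; field.
  move: fpsi; rewrite half; set N := 3^-1 ^+ n * rnorm (x n) in psige big *.
  by move=> fpsi; lra.
have [y Ay yP] := weakly_compact_seq_cluster Ac (fun n => (xP n).1).
have [n] := yP f 1 (Num.truncn (`|f y| + 1)).+1 ltr01 (real_functional_weak_continuous fb).
move=> nbig fny; have := fx n; apply/negP; rewrite -ltNge.
have tri : `|f (x n)| <= `|f y| + `|f (x n) - f y|.
  by rewrite -{1}(subrK (f y) (f (x n))) addrC ler_normD.
apply: le_lt_trans tri _; apply: lt_trans (_ : `|f y| + 1 < _); first by rewrite ltrD2l.
apply: lt_le_trans (truncnS_gt _) _.
by rewrite ler_nat.
Qed.

(** A filter on the union that does not cluster at 0 avoids a weak neighbourhood
    of 0, hence lives on finitely many of the sets. *)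
Lemma weakly_compact_null_union (G : nat -> set X) :
  (forall n, weakly_compact (G n)) ->
  (forall e : R, 0 < e -> exists N, forall n, (N <= n)%N ->
    forall g, G n g -> rnorm g < e) ->
  weakly_compact ([set 0] `|` \bigcup_n G n).
Proof.
move=> Gc Gnull F FF FG.
have [c0|] := pselect (@cluster (weak X) F 0); first by exists 0; split=> //; left.
move=> /existsNP[B /existsNP[U /not_implyP[FB /not_implyP[U0 BU]]]].
have [N NU] : exists N, forall n, (N <= n)%N -> G n `<=` U.
  have : nbhs (0 : X) U by exact: (@norm_weak_continuous R k X).
  move=> /nbhs_ballP[e e0 eU].
  have /Gnull[N Ge] : 0 < scalar_re e.
    by rewrite -(@scalar_in_lt R k) scalar_inK ?rmorph0 // ltW.
  exists N => n Nn g Gg; apply: eU; rewrite -ball_normE /= sub0r normrN.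
  by rewrite normr_rnorm -(scalar_inK (ltW e0)) scalar_in_lt (Ge n).
pose H := \big[setU/set0]_(n < N) G n.
have Hc : @compact (weak X) H by apply: bigsetU_compact => n _; exact: Gc.
have FH : F H.
  apply: filterS (filterI FB FG) => z [Bz].
  have nUz : ~ U z by move=> Uz; apply: BU; exists z.
  case=> [z0|[n _ Gz]]; first by case: nUz; rewrite z0; exact: nbhs_singleton U0.
  have [Nn|nN] := leqP N n; first by case: nUz; exact: NU Gz.
  by rewrite /H -bigcup_mkord; exists n.
have [z [Hz zc]] := Hc F FF FH; exists z; split=> //.
by right; move: Hz; rewrite /H -bigcup_mkord => -[n _ Gz]; exists n.
Qed.

End WeakCompactness.

(** * The gliding hump *)

Section GlidingHump.
Variables (R : realType) (k : scalar_kind).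
Local Notation K := (scalars R k).
Local Notation weak X := (initial_topology (@dual_eval K X)).
Variable X : normedModType K.

Lemma bounded_partial_sums_tail (u : nat -> R) (C e : R) :
  (forall i, 0 <= u i) -> (forall n, \sum_(0 <= i < n) u i <= C) -> 0 < e ->
  exists N, forall m, \sum_(N <= i < m) u i <= e.
Proof.
move=> u0 uC e0; pose S := [set \sum_(0 <= i < n) u i | n in setT].
have hS : has_sup S.
  by split; [exists (\sum_(0 <= i < 0) u i), 0%N|exists C => _ [n _ <-]].
have [_ [N _ <-] NS] := sup_adherent e0 hS; exists N => m.
have [mN|/ltnW Nm] := leqP m N; first by rewrite big_geq // ltW.
have : \sum_(0 <= i < m) u i <= sup S by apply: ub_le_sup; [exact: hS.2|exists m].
rewrite (@big_cat_nat _ _ _ N 0 m)//= -lerBrDl => /le_trans; apply.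
by rewrite lerBlDr addrC -lerBlDr ltW.
Qed.

Lemma sum_subsequence_le (s : nat -> nat) (u : nat -> R) i n :
  (forall m, (s m < s m.+1)%N) -> (forall j, 0 <= u j) -> (i <= n)%N ->
  \sum_(i <= m < n.+1) u (s m) <= \sum_(s i <= l < (s n).+1) u l.
Proof.
move=> sS u0 /subnKC <-; elim: (n - i)%N => [|d IH].
  by rewrite addn0 !big_nat1.
rewrite addnS big_nat_recr /=; last by rewrite -addnS leq_addr.
have smono : {homo s : x y / (x <= y)%N}.
  by apply: homo_leq => //; [exact: leq_trans|move=> x; exact: ltnW].
rewrite [leRHS]big_nat_recr /=; last by rewrite smono // -addnS leq_addr.
rewrite lerD2r (le_trans IH) // (@big_cat_nat _ _ _ (s (i + d)%N).+1 _ (s (i + d).+1))//=.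
  by rewrite lerDl sumr_ge0.
by rewrite ltnW // ltnS smono // leq_addr.
Qed.

(** The map [z |-> (a i z)_i] is bounded into the space of summable sequences,
    so this says that weakly compact sets of summable sequences have uniformly
    small coordinates (Schur).  Let [T0] be a weak cluster point of [T], and pass
    to a subsequence [s] such that, at [T (s m) - T0], the coordinates [s l] with
    [l < m] and those with [l > m] are negligible.  Then the functional
    [f = sum_m a (s m)] stays away from [f T0] along [T (s m)].  But a cluster
    point [T1] of [T (s m)] has the same coordinates [s l] as [T0], hence
    [f T1 = f T0]. *)
Lemma summable_functionals_diagonal (A : set X) (a : nat -> X -> R) (C : R)
    (T : nat -> X) (e : R) : weakly_compact A -> (forall i, real_linear (a i)) ->
  (forall z n, \sum_(0 <= i < n) `|a i z| <= C * rnorm z) ->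
  (forall i, A (T i)) -> 0 < e -> exists i, `|a i (T i)| < e.
Proof.
move=> Ac al aC AT e0; apply: contrapT => /forallNP large.
have {}large i : e <= `|a i (T i)| by rewrite leNgt; apply/negP; exact: large.
have ab i : real_functional (a i).
  split=> //; exists C => z; apply: le_trans (aC z i.+1).
  by rewrite big_nat_recr //= lerDr sumr_ge0.
have tail z d : 0 < d -> exists N, forall m, \sum_(N <= l < m) `|a l z| <= d.
  by apply: bounded_partial_sums_tail => // i; exact: aC.
have [T0 AT0 T0P] := weakly_compact_seq_cluster Ac AT.
pose d i := T i - T0.
have e2 : 0 < e / 2 by rewrite divr_gt0.
have e8 : 0 < e / 8 by rewrite divr_gt0.
have [N0 N0P] : exists N0, forall i, (N0 <= i)%N -> e / 2 <= `|a i (d i)|.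
  have [N NP] := tail T0 _ e2; exists N => i Ni.
  have ai0 : `|a i T0| <= e / 2.
    by apply: le_trans (NP i.+1); rewrite big_nat_recr //= lerDr sumr_ge0.
  have tri : `|a i (T i)| <= `|a i (d i)| + `|a i T0|.
    by rewrite /d (real_linearB (al i)) -{1}(subrK (a i T0) (a i (T i))) ler_normD.
  by have := large i; lra.
(* The bound on the coordinates up to i tends to 0 with i: it serves both to
   make them negligible and to identify the coordinates of T1. *)
have /choice[next nextP] i : exists j, [/\ (i < j)%N,
    forall m, \sum_(j <= l < m) `|a l (d i)| <= e / 8 &
    \sum_(0 <= l < i.+1) `|a l (d j)| <= e / 8 / i.+1%:R].
  have [N NP] := tail (d i) _ e8.
  pose r z : R := \sum_(0 <= l < i.+1) `|a l z - a l T0|.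
  have rc : continuous (r : weak X -> R).
    have rlc l : continuous (fun z : weak X => `|a l z - a l T0| : R).
      move=> z; apply: (@continuous_comp (weak X) R R (a l) (fun v => `|v - a l T0|)).
        exact: real_functional_weak_continuous.
      by apply: (@cvg_norm _ R^o); apply: (@cvgB _ R^o); [exact: cvg_id|exact: cvg_cst].
    by apply: (@continuous_big R nat +%R 0 xpredT) => // z;
       apply: (@cvgD _ R^o); [exact: cvg_fst|exact: cvg_snd].
  have r0 : r T0 = 0 by rewrite /r big1 // => l _; rewrite subrr normr0.
  have ei : 0 < e / 8 / i.+1%:R by rewrite divr_gt0.
  have [j] := T0P r _ (maxn N i.+1) ei rc.
  rewrite geq_max => /andP[Nj ij] rj; exists j; split=> //.
    move=> m; have [mj|jm] := leqP m j; first by rewrite big_geq // ltW.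
    apply: le_trans (NP m); rewrite (@big_cat_nat _ _ _ j N m)//= ?(ltnW jm)//.
    by rewrite lerDr sumr_ge0.
  under eq_bigr do rewrite /d (real_linearB (al _)).
  by move: rj; rewrite r0 subr0 ger0_norm ?sumr_ge0// => /ltW.
(* Starting at N0 makes the coordinates of T0 itself harmless. *)
pose s m := iter m next N0.
have sS m : (s m < s m.+1)%N by case: (nextP (s m)).
have sm m : (m <= s m)%N by elim: m => // m IH; apply: leq_ltn_trans IH (sS m).
have sN0 m : (N0 <= s m)%N.
  by elim: m => // m IH; apply: leq_trans IH (ltnW (sS m)).
pose b m := a (s m); have bl m : real_linear (b m) by exact: al.
have head m : \sum_(0 <= l < m.+1) `|b l (d (s m.+1))| <= e / 8 / (m.+1)%:R.
  have [_ _ aj] := nextP (s m).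
  apply: le_trans (_ : _ <= e / 8 / (s m).+1%:R) _; last first.
    by rewrite ler_wpM2l ?(ltW e8)// lef_pV2 ?posrE// ler_nat ltnS.
  apply: le_trans aj.
  have := sum_subsequence_le sS (fun j => normr_ge0 (a j (d (s m.+1)))) (leq0n m).
  move=> /le_trans; apply; rewrite [leRHS](@big_cat_nat _ _ _ (s 0%N))//=; last first.
    by apply: leqW; exact: sN0.
  by rewrite lerDr sumr_ge0.
have btail z n m : (forall m', \sum_(s n <= l < m') `|a l z| <= e / 8) ->
    \sum_(n <= l < m) `|b l z| <= e / 8.
  move=> h; have [mn|] := leqP m n; first by rewrite big_geq // ltW.
  case: m => // m nm; apply: le_trans (h (s m).+1).
  exact: (sum_subsequence_le sS (fun j => normr_ge0 (a j z))).
have [|f fb fS] := real_functional_series (C := C) (fun m => al (s m)).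
  move=> z [|n]; first by rewrite big_geq // (le_trans _ (aC z 0%N))// big_geq.
  apply: le_trans (sum_subsequence_le sS (fun j => normr_ge0 (a j z)) (leq0n n)) _.
  apply: le_trans (aC z (s n).+1).
  have s0n : (s 0 <= (s n).+1)%N by apply: leqW; exact: sN0.
  by rewrite [leRHS](@big_cat_nat _ _ _ (s 0%N))//= lerDr sumr_ge0.
have fd m : e / 4 <= `|f (d (s m))|.
  have [_ at_ _] := nextP (s m).
  have := fS (d (s m)) m.+1 (e / 8) (fun m' => btail _ m.+1 m' at_).
  rewrite big_nat_recr //=.
  have : `|\sum_(0 <= i < m) b i (d (s m))| <= e / 8.
    case: m at_ => [|m] _; first by rewrite big_geq // normr0 ltW.
    apply: le_trans (ler_norm_sum _ _ _) _; apply: le_trans (head m) _.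
    by rewrite ler_pdivrMr // ler_peMr ?(ltW e8)// ler1n.
  have := N0P (s m) (sN0 m); rewrite -/(b m).
  set u := \sum_(0 <= i < m) _; set v := b m _; set w := f _ => ve ue fe.
  have : `|v| <= `|w| + `|w - (u + v)| + `|u|.
    have {1}-> : v = w - (w - (u + v)) - u by ring.
    by rewrite (le_trans (ler_normB _ _))// lerD2r ler_normB.
  by lra.
have [T1 AT1 T1P] := weakly_compact_seq_cluster Ac (fun m => AT (s m)).
have b10 l : b l T1 = b l T0.
  apply/eqP; rewrite -subr_eq0 -normr_le0; apply/ler_addgt0Pr => g g0.
  have g2 : 0 < g / 2 by rewrite divr_gt0.
  pose N := (Num.truncn (e / 8 / (g / 2))).+1.
  have [[|m]] := T1P (b l) _ (maxn N l.+1) g2 (real_functional_weak_continuous (ab _)).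
    by rewrite geq_max ltn0 andbF.
  rewrite geq_max => /andP[Nm lm] bT1.
  have bd : `|b l (d (s m.+1))| <= g / 2.
    apply: le_trans (_ : _ <= e / 8 / m.+1%:R) _.
      apply: le_trans (head m).
      rewrite (@big_cat_nat _ _ _ l)//= ?(ltnW lm)// [X in _ + X]big_ltn // addrCA.
      by rewrite lerDl addr_ge0 ?sumr_ge0.
    rewrite ler_pdivrMr // [leRHS]mulrC -ler_pdivrMr //.
    by apply: le_trans (ltW (truncnS_gt _)) _; rewrite ler_nat.
  have -> : b l T1 - b l T0 = b l (d (s m.+1)) - (b l (T (s m.+1)) - b l T1).
    by rewrite /d (real_linearB (bl _)); ring.
  by rewrite (le_trans (ler_normB _ _))// add0r (splitr g) lerD // ltW.
have f10 : f T1 = f T0.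
  apply/eqP; rewrite -subr_eq0 -(real_linearB fb.1) -normr_le0.
  have := fS (T1 - T0) 0%N 0; rewrite big_geq // subr0; apply => m.
  by rewrite big1 // => l _; rewrite -/(b l) (real_linearB (bl _)) b10 subrr normr0.
have e4 : 0 < e / 4 by rewrite divr_gt0.
have [m _] := T1P f _ 0%N e4 (real_functional_weak_continuous fb).
by rewrite f10 -(real_linearB fb.1) ltNge fd.
Qed.

End GlidingHump.

(** * Operators with strongly generated image *)

Section StronglyGenerated.
Variables (R : realType) (k : scalar_kind).
Local Notation K := (scalars R k).

(** Relative version of the SWCG property: the images under [L] of the weakly
    compact sets are strongly generated, by countably many weakly compact sets
    instead of the multiples of a single one.  In this form the property is
    stable under sums, compositions and uniform approximation on weakly compact
    sets. *)
Definition strongly_generated (X Y : normedModType K) (L : X -> Y) :=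
  exists2 G : nat -> set Y, (forall i, weakly_compact (G i)) &
    forall A, weakly_compact A -> forall e : R, 0 < e ->
      exists i, forall x, A x -> exists2 g, G i g & rnorm (L x - g) <= e.

Lemma strongly_generated_count (I : countType) (X Y : normedModType K) (L : X -> Y)
    (G : I -> set Y) : (forall i, weakly_compact (G i)) ->
  (forall A, weakly_compact A -> forall e : R, 0 < e ->
    exists i, forall x, A x -> exists2 g, G i g & rnorm (L x - g) <= e) ->
  strongly_generated L.
Proof.
move=> Gc LG; exists (fun n => if choice.unpickle n is Some i then G i else [set 0]).
  by move=> n; case: choice.unpickle => [i|]; [exact: Gc|exact: weakly_compact_set0].
move=> A Ac e e0; have [i iP] := LG A Ac e e0; exists (choice.pickle i) => x Ax.
by rewrite choice.pickleK; exact: iP.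
Qed.

Lemma strongly_generated0 (X Y : normedModType K) :
  strongly_generated (fun _ : X => 0 : Y).
Proof.
exists (fun=> [set 0]) => [_|A Ac e e0]; first exact: weakly_compact_set0.
by exists 0%N => x Ax; exists 0 => //; rewrite subrr rnorm0 ltW.
Qed.

Lemma strongly_generatedD (X Y : normedModType K) (L M : X -> Y) :
  strongly_generated L -> strongly_generated M ->
  strongly_generated (fun x => L x + M x).
Proof.
move=> [G Gc LG] [H Hc MH].
apply: (@strongly_generated_count _ _ _ _
  (fun ij : nat * nat => [set a + b | a in G ij.1 & b in H ij.2])).
  by move=> ij; exact: weakly_compact_add.
move=> A Ac e e0; have e2 : 0 < e / 2 by rewrite divr_gt0.
have [[i iP] [j jP]] := (LG A Ac _ e2, MH A Ac _ e2).
exists (i, j) => x Ax; have [[g Gg Lg] [h Hh Mh]] := (iP x Ax, jP x Ax).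
exists (g + h); first by exists g => //; exists h.
by rewrite opprD addrACA (splitr e) (le_trans (rnormD _ _))// lerD.
Qed.

Lemma strongly_generated_sum (X Y : normedModType K) (T : Type) (s : seq T)
    (L : T -> X -> Y) : (forall i, strongly_generated (L i)) ->
  strongly_generated (fun x => \sum_(i <- s) L i x).
Proof.
move=> Lg; elim: s => [|i s IH].
  have := strongly_generated0 X Y.
  by congr strongly_generated; apply/funext => x; rewrite big_nil.
have := strongly_generatedD (Lg i) IH.
by congr strongly_generated; apply/funext => x; rewrite big_cons.
Qed.

Lemma strongly_generated_comp (X Y Z : normedModType K) (L : Y -> Z) (M : X -> Y) :
  strongly_generated L -> bounded_linear M -> strongly_generated (fun x => L (M x)).
Proof.
move=> [G Gc LG] Mb; exists G => // A Ac e e0.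
have [i iP] := LG _ (weakly_compact_image Mb Ac) e e0.
by exists i => x Ax; apply: iP; exists x.
Qed.

Lemma strongly_generated_approx (X Y : normedModType K) (L : X -> Y)
    (M : nat -> X -> Y) : (forall n, strongly_generated (M n)) ->
  (forall A, weakly_compact A -> forall e : R, 0 < e ->
    exists n, forall x, A x -> rnorm (L x - M n x) <= e) ->
  strongly_generated L.
Proof.
move=> Mg LM.
have /choice[G GP] n : exists G : nat -> set Y, (forall i, weakly_compact (G i)) /\
    forall A, weakly_compact A -> forall e : R, 0 < e ->
      exists i, forall x, A x -> exists2 g, G i g & rnorm (M n x - g) <= e.
  by have [G Gc GM] := Mg n; exists G.
apply: (@strongly_generated_count _ _ _ _ (fun ni : nat * nat => G ni.1 ni.2)).
  by move=> ni; exact: (GP _).1.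
move=> A Ac e e0; have e2 : 0 < e / 2 by rewrite divr_gt0.
have [n nP] := LM A Ac _ e2; have [i iP] := (GP n).2 A Ac _ e2.
exists (n, i) => x Ax; have [g Gg Mg'] := iP x Ax; exists g => //.
by rewrite (splitr e) (le_trans (rnorm_triangle _ (M n x) _))// lerD // nP.
Qed.

Lemma eps_ball_rnorm (X : normedModType K) (eps : K) (x : X) : 0 < eps ->
  rnorm x <= scalar_re eps ->
  exists2 b : X, `|b| <= 1 & eps *: b = x.
Proof.
move=> e0 xe; exists (eps^-1 *: x); last by rewrite scalerA divff ?gt_eqF// scale1r.
rewrite normrZ normfV ger0_norm ?(ltW e0)// mulrC ler_pdivrMr // mul1r.
by rewrite normr_rnorm -(scalar_inK (ltW e0)) scalar_in_le.
Qed.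

Lemma strongly_generated_swcg (X Y Z : normedModType K) (A : X -> Y) (B : Y -> Z) :
  swcg Y -> bounded_linear A -> bounded_linear B ->
  strongly_generated (fun x => B (A x)).
Proof.
move=> [G Gc GY] Ab Bb; have [C C0 BC] := bounded_linearP Bb.
have nb (n : nat) : bounded_linear (fun y => B (n%:R *: y)).
  apply: bounded_linear_comp => //.
  by apply: bounded_linear_scale; exact: bounded_linear_id.
exists (fun n => (fun y => B (n%:R *: y)) @` G).
  by move=> n; exact: weakly_compact_image.
move=> H Hc e e0.
have eC : 0 < scalar_in (e / C) :> K.
  by rewrite -(rmorph0 scalar_in) scalar_in_lt divr_gt0.
have [n nP] := GY _ (weakly_compact_image Ab Hc) _ eC; exists n => x Hx.
have [|g Gg [b b1 gb]] := nP (A x); first by exists x.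
exists (B (n%:R *: g)); first by exists g.
rewrite -(bounded_linearB Bb) -gb addrAC subrr add0r.
have eC0 : 0 <= e / C by rewrite divr_ge0 // ltW.
apply: le_trans (BC _) _; rewrite mulrC -ler_pdivlMr // rnormZr ger0_norm //.
rewrite ler_piMr //.
by rewrite -(@scalar_in_le R k) -normr_rnorm rmorph1.
Qed.

(** For the identity, a single set suffices: once the [i]-th generating set is
    scaled into the ball of radius [1 / (i + 1)], the union of all of them, with 0
    added, is weakly compact. *)
Lemma swcg_strongly_generated (X : normedModType K) :
  strongly_generated (@id X) -> swcg X.
Proof.
move=> [G Gc GX].
have /choice[M MP] i : exists M : R, forall x, G i x -> rnorm x <= M.
  exact: (weakly_compact_bounded (Gc i)).
pose N i := (Num.truncn (`|M i| * i.+1%:R)).+1.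
pose f i (x : X) := (N i)%:R^-1 *: x.
have fb i : bounded_linear (f i).
  by apply: bounded_linear_scale; exact: bounded_linear_id.
pose H i := f i @` G i.
exists ([set 0] `|` \bigcup_i H i).
  apply: weakly_compact_null_union => [i|e e0]; first exact: weakly_compact_image.
  exists (Num.truncn e^-1) => n Nn _ [g Gg <-].
  have -> : f n g = scalar_in (N n)%:R^-1 *: g by rewrite /f fmorphV rmorph_nat.
  rewrite rnormZr ger0_norm ?invr_ge0// mulrC ltr_pdivrMr //.
  have Mg : rnorm g <= `|M n| by apply: le_trans (ler_norm _); exact: MP.
  apply: le_lt_trans Mg _; rewrite mulrC -ltr_pdivrMr //.
  apply: le_lt_trans (_ : _ <= `|M n| * n.+1%:R) (truncnS_gt _).
  rewrite ler_wpM2l //; apply: ltW; apply: lt_le_trans (truncnS_gt _) _.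
  by rewrite ler_nat.
move=> A Ac eps eps0.
have e0 : 0 < scalar_re eps.
  by rewrite -(@scalar_in_lt R k) scalar_inK ?rmorph0 // ltW.
have [i iP] := GX A Ac _ e0; exists (N i) => x Ax; have [g Gg xg] := iP x Ax.
have [b b1 bx] := eps_ball_rnorm eps0 xg.
exists (f i g); first by right; exists i => //; exists g.
exists b => //; rewrite bx /f scalerA divff ?pnatr_eq0// scale1r.
by rewrite addrC subrK.
Qed.

End StronglyGenerated.

(** * Bounded bilinear maps on the projective tensor product *)

Section TensorProduct.
Variables (R : realType) (k : scalar_kind).
Local Notation K := (scalars R k).
Variables (X Y Z : completeNormedModType K) (t : {bilinear X -> Y -> Z}).
Hypothesis ht : is_projective_tensor_product t.

Lemma tensor_sum_cat (V : lmodType K) (b : {bilinear X -> Y -> V}) s s' :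
  tensor_sum b (s ++ s') = tensor_sum b s + tensor_sum b s'.
Proof. exact: big_cat. Qed.

Lemma tensor_sum_scale (V : lmodType K) (b : {bilinear X -> Y -> V}) (a : K) s :
  tensor_sum b [seq (a *: u.1, u.2) | u <- s] = a *: tensor_sum b s.
Proof.
by rewrite /tensor_sum big_map scaler_sumr; apply: eq_bigr => u _; rewrite linearZl_LR.
Qed.

Lemma tensor_sum1 (V : lmodType K) (b : {bilinear X -> Y -> V}) x y :
  tensor_sum b [:: (x, y)] = b x y.
Proof. exact: big_seq1. Qed.

Lemma tensor_sum_eq (V : lmodType K) (b : {bilinear X -> Y -> V}) s s' :
  tensor_sum t s = tensor_sum t s' -> tensor_sum b s = tensor_sum b s'.
Proof.
move=> ss'; apply/eqP; rewrite -subr_eq0 -scaleN1r -tensor_sum_scale -tensor_sum_cat.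
apply/eqP; apply: (ptp_algebraic ht).
by rewrite tensor_sum_cat tensor_sum_scale ss' scaleN1r subrr.
Qed.

Lemma tensor_sum_approx (z : Z) (e : R) : 0 < e ->
  exists s, rnorm (z - tensor_sum t s) < e.
Proof.
move=> e0; have e0' : 0 < scalar_in e :> K by rewrite -(rmorph0 scalar_in) scalar_in_lt.
have [|z' [zs [s _ sz']]] :=
  ptp_dense ht (O := interior (ball z (scalar_in e))) _ (open_interior _).
  by exists z; exact: nbhsx_ballx.
exists s; rewrite sz'; move: (interior_subset zs); rewrite -ball_normE /=.
by rewrite normr_rnorm scalar_in_lt.
Qed.

Lemma tensor_sum_rnorm_le s (C m : R) : 0 <= C ->
  (forall s', tensor_sum t s' = tensor_sum t s ->
     m <= C * \sum_(u <- s') rnorm u.1 * rnorm u.2) ->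
  m <= C * rnorm (tensor_sum t s).
Proof.
rewrite le_eqVlt => /predU1P[<-|C0] mC; first by have := mC s erefl; rewrite !mul0r.
rewrite mulrC -ler_pdivrMr // (ptp_norm ht); apply: (le_inf_set (i0 := s)) => // s' /mC.
by rewrite ler_pdivrMr // mulrC.
Qed.

Lemma rnorm_tensor x y : rnorm (t x y) <= rnorm x * rnorm y.
Proof.
rewrite -tensor_sum1 (ptp_norm ht).
have := @inf_le R _ [set s' | tensor_sum t s' = tensor_sum t [:: (x, y)]]
  (fun s' => \sum_(u <- s') rnorm u.1 * rnorm u.2) 0 [:: (x, y)].
rewrite big_seq1; apply=> // s' _.
by apply: sumr_ge0 => u _; rewrite mulr_ge0 ?rnorm_ge0.
Qed.

(** The projective norm is the largest seminorm bounded by the product of the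
    norms on elementary tensors; the bound by [M] gives the passage to the
    completion. *)
Lemma tensor_bound (N : Z -> R) (C M : R) : 0 <= C -> N 0 <= 0 ->
  (forall u v, N (u + v) <= N u + N v) -> (forall u, N u <= M * rnorm u) ->
  (forall x y, N (t x y) <= C * (rnorm x * rnorm y)) ->
  forall z, N z <= C * rnorm z.
Proof.
move=> C0 N0 ND NM Nt z.
have Ns s : N (tensor_sum t s) <= C * rnorm (tensor_sum t s).
  apply: tensor_sum_rnorm_le => // s' <-; rewrite /tensor_sum.
  elim: s' => [|u s' IH]; first by rewrite !big_nil mulr0.
  by rewrite !big_cons mulrDr (le_trans (ND _ _))// lerD.
apply/ler_addgt0Pr => e e0.
have CM : 0 < C + `|M| + 1 by rewrite ltr_wpDl // addr_ge0.
have [s zs] := tensor_sum_approx z (divr_gt0 e0 CM).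
have -> : z = tensor_sum t s + (z - tensor_sum t s) by rewrite addrC subrK.
apply: le_trans (ND _ _) _; set w := z - _ in zs *.
have Nw : N w <= `|M| * rnorm w.
  by apply: le_trans (NM w) _; rewrite ler_wpM2r ?rnorm_ge0 ?ler_norm.
have ws : rnorm (tensor_sum t s) <= rnorm (tensor_sum t s + w) + rnorm w.
  by rewrite -{1}(addrK w (tensor_sum t s)) rnormB.
apply: le_trans (lerD (Ns s) Nw) _.
apply: le_trans (_ : _ <= C * (rnorm (tensor_sum t s + w) + rnorm w) + `|M| * rnorm w) _.
  by rewrite lerD2r ler_wpM2l.
rewrite mulrDr -addrA lerD2l -mulrDl.
move: zs; rewrite ltr_pdivlMr // => /ltW; apply: le_trans.
by rewrite mulrC ler_wpM2l ?rnorm_ge0 // lerDl.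
Qed.

Lemma tensor_ind (P : Z -> Prop) : P 0 -> (forall u v, P u -> P v -> P (u + v)) ->
  (forall x y, P (t x y)) ->
  (forall z, (forall e : R, 0 < e -> exists2 u, P u & rnorm (z - u) < e) -> P z) ->
  forall z, P z.
Proof.
move=> P0 PD Pt Plim z; apply: Plim => e e0; have [s zs] := tensor_sum_approx z e0.
by exists (tensor_sum t s) => //; apply: big_ind => // u _; exact: Pt.
Qed.

Lemma tensor_ext (W : normedModType K) (L M : Z -> W) :
  bounded_linear L -> bounded_linear M -> (forall x y, L (t x y) = M (t x y)) ->
  forall z, L z = M z.
Proof.
move=> Lb Mb LM z; apply/eqP; rewrite -subr_eq0; apply/eqP/rnorm_eq0/le_anti.
have LMb := bounded_linear_sub Lb Mb.
have [C _ LMC] := bounded_linearP LMb.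
rewrite rnorm_ge0 andbT -(mul0r (rnorm z)).
apply: (@tensor_bound (fun z => rnorm (L z - M z)) 0 C) => // [|u v|x y].
- by rewrite (bounded_linear0 LMb) rnorm0.
- by rewrite (bounded_linearD LMb) rnormD.
- by rewrite LM subrr rnorm0 mul0r.
Qed.

(** A bounded bilinear map extends to the projective tensor product: the value
    at [z] is the only [w] for which [tensor_sum b s] is as close to [w], up to
    the constant, as [tensor_sum t s] is to [z]. *)
Lemma tensor_lift (W : completeNormedModType K) (b : {bilinear X -> Y -> W}) (C : R) :
  (forall x y, rnorm (b x y) <= C * (rnorm x * rnorm y)) ->
  exists2 L : Z -> W, bounded_linear L & forall x y, L (t x y) = b x y.
Proof.
move=> bC0; pose D := Num.max C 0; have D0 : 0 <= D by rewrite le_max lexx orbT.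
have {bC0}bD s : rnorm (tensor_sum b s) <= D * rnorm (tensor_sum t s).
  apply: tensor_sum_rnorm_le => // s' /esym ss'; rewrite (tensor_sum_eq b ss') /tensor_sum.
  apply: le_trans (rnorm_sum _ _) _; rewrite mulr_sumr; apply: ler_sum => u _.
  by apply: le_trans (bC0 _ _) _; rewrite ler_wpM2r ?mulr_ge0 ?rnorm_ge0 // le_max lexx.
have bB s s' : rnorm (tensor_sum b s - tensor_sum b s') <=
    D * rnorm (tensor_sum t s - tensor_sum t s').
  by rewrite -!(scaleN1r (tensor_sum _ s')) -!tensor_sum_scale -!tensor_sum_cat.
pose near z w := forall s, rnorm (tensor_sum b s - w) <= D * rnorm (tensor_sum t s - z).
have small (e : R) : 0 < e -> exists2 d : R, 0 < d & D * d <= e.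
  move=> e0; exists (e / (D + 1)); first by rewrite divr_gt0 // ltr_wpDl.
  by rewrite mulrCA ler_piMr ?(ltW e0)// ler_pdivrMr ?ltr_wpDl// mul1r lerDl.
have near_uniq z w w' : near z w -> near z w' -> w = w'.
  move=> zw zw'; apply/eqP; rewrite -subr_eq0; apply/eqP/rnorm_eq0/le_anti.
  rewrite rnorm_ge0 andbT; apply/ler_addgt0Pr => e e0; rewrite add0r.
  have [d d0 Dd] := small (e / 2) (divr_gt0 e0 (ltr0n _ 2)).
  have [s zs] := tensor_sum_approx z d0.
  have De : D * rnorm (tensor_sum t s - z) <= e / 2.
    by apply: le_trans Dd; rewrite ler_wpM2l // rdistC ltW.
  apply: le_trans (rnorm_triangle _ (tensor_sum b s) _) _; rewrite (splitr e) rdistC.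
  by rewrite lerD // (le_trans _ De).
have near_ex z : exists w, near z w.
  have /choice[s sP] (n : nat) : exists s, rnorm (z - tensor_sum t s) < n.+1%:R^-1.
    by apply: tensor_sum_approx; rewrite invr_gt0.
  pose w n := tensor_sum b (s n).
  have inv_small (d : R) : 0 < d -> exists N, forall n, (N <= n)%N -> n.+1%:R^-1 < d.
    move=> d0; exists (Num.truncn d^-1) => n Nn; rewrite invf_plt ?posrE//.
    by apply: lt_le_trans (truncnS_gt _) _; rewrite ler_nat.
  have wcvg : cvgn w.
    apply/cauchy_cvgP/cauchyP => /= e e0.
    have e1 : 0 < scalar_re e by rewrite -(@scalar_in_lt R k) scalar_inK ?rmorph0 // ltW.
    have [d d0 Dd] := small (scalar_re e / 3) (divr_gt0 e1 (ltr0n _ 3)).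
    have [N NP] := inv_small d d0; exists (w N), N => //= n Nn.
    rewrite -ball_normE /= normr_rnorm -(scalar_inK (ltW e0)) scalar_in_lt.
    apply: le_lt_trans (bB _ _) _.
    apply: le_lt_trans (_ : _ <= D * (d + d)) _; last by rewrite mulrDr; lra.
    rewrite ler_wpM2l // (le_trans (rnorm_triangle _ z _))// rdistC lerD //.
      by rewrite ltW // (lt_trans (sP _)) // NP.
    by rewrite ltW // (lt_trans (sP _)) // NP.
  exists (limn w) => s'; apply/ler_addgt0Pr => e e0.
  have [d d0 Dd] := small (e / 2) (divr_gt0 e0 (ltr0n _ 2)).
  have [N NP] := inv_small d d0.
  have /cvg_rnormP/(_ (e / 2) (divr_gt0 e0 (ltr0n _ 2)))[M _ MP] := wcvg.
  pose n := maxn N M.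
  apply: le_trans (rnorm_triangle _ (w n) _) _.
  have h1 : rnorm (w n - limn w) <= e / 2 by rewrite rdistC ltW // MP //= leq_maxr.
  have h2 : rnorm (tensor_sum b s' - w n) <= D * rnorm (tensor_sum t s' - z) + e / 2.
    apply: le_trans (bB _ _) _.
    apply: le_trans (_ : _ <= D * (rnorm (tensor_sum t s' - z) + d)) _.
      rewrite ler_wpM2l // (le_trans (rnorm_triangle _ z _))// lerD2l.
      by rewrite ltW // (lt_trans (sP _)) // NP // leq_maxl.
    by rewrite mulrDr lerD2l.
  by apply: le_trans (lerD h2 h1) _; rewrite -addrA -splitr.
have /choice[L LP] := near_ex.
have Lt s : L (tensor_sum t s) = tensor_sum b s.
  by apply: near_uniq (LP _) _ => s'; exact: bB.
exists L; last by move=> x y; rewrite -tensor_sum1 Lt tensor_sum1.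
split=> [a u v|]; last first.
  by exists D => z; have := LP z [::]; rewrite /tensor_sum !big_nil !sub0r !rnormN.
apply: near_uniq (LP _) _ => s; apply/ler_addgt0Pr => e e0.
have [d d0 Dd] := small _ (divr_gt0 e0 (ltr0n _ 2)).
pose d' := d / (rnorm (a : K^o) + 1).
have a1 : 0 < rnorm (a : K^o) + 1 by rewrite ltr_wpDl ?rnorm_ge0.
have d'0 : 0 < d' by rewrite divr_gt0.
have [[su suP] [sv svP]] := (tensor_sum_approx u d'0, tensor_sum_approx v d'0).
have ad' : rnorm (a : K^o) * d' + d' = d.
  by rewrite -{2}[d']mul1r -mulrDl /d' mulrCA divff ?mulr1 // gt_eqF.
pose s' := [seq (a *: w.1, w.2) | w <- su] ++ sv.
have s'u : rnorm (tensor_sum t s' - (a *: u + v)) <= d.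
  rewrite tensor_sum_cat tensor_sum_scale opprD addrACA -scalerBr.
  apply: le_trans (rnormD _ _) _; rewrite rnormZ -ad' lerD //.
    by rewrite ler_wpM2l ?rnorm_ge0 // rdistC ltW.
  by rewrite rdistC ltW.
have s'L : rnorm (tensor_sum b s' - (a *: L u + L v)) <= D * d.
  rewrite tensor_sum_cat tensor_sum_scale opprD addrACA -scalerBr.
  apply: le_trans (rnormD _ _) _; rewrite rnormZ -ad' mulrDr lerD //.
    rewrite mulrCA ler_wpM2l ?rnorm_ge0 // (le_trans (LP _ _))// ler_wpM2l //.
    by rewrite rdistC ltW.
  by rewrite (le_trans (LP _ _))// ler_wpM2l // rdistC ltW.
apply: le_trans (rnorm_triangle _ (tensor_sum b s') _) _.
have h : rnorm (tensor_sum b s - tensor_sum b s') <=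
    D * rnorm (tensor_sum t s - (a *: u + v)) + D * d.
  apply: le_trans (bB _ _) _; rewrite -mulrDr ler_wpM2l //.
  by rewrite (le_trans (rnorm_triangle _ (a *: u + v) _))// lerD2l rdistC.
apply: le_trans (lerD h s'L) _; rewrite -addrA lerD2l.
by rewrite (splitr e) lerD.
Qed.

Lemma tensor_map_bilinear (A : X -> X) (B : Y -> Y) :
  bounded_linear A -> bounded_linear B ->
  exists2 L : Z -> Z, bounded_linear L & forall x y, L (t x y) = t (A x) (B y).
Proof.
move=> Ab Bb; pose b x y := t (A x) (B y).
have bl : bilinear_for *:%R *:%R b.
  by split=> [y a u v|x a u v]; rewrite /b ?Ab.1 ?Bb.1 ?linearPl ?linearPr.
pose bM := bilinear_isBilinear.Build K X Y Z *:%R *:%R b bl.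
pose b' : {bilinear X -> Y -> Z} := HB.pack b bM.
have [[C C0 AC] [D D0 BD]] := (bounded_linearP Ab, bounded_linearP Bb).
apply: (@tensor_lift _ b' (C * D)) => x y.
apply: le_trans (rnorm_tensor _ _) _; rewrite mulrACA.
by rewrite ler_pM ?rnorm_ge0.
Qed.

(** Contracting the first factor against a functional is what makes operators of
    finite rank on [X] act on [Z] through finitely many copies of [Y]. *)
Lemma tensor_contractl (l : X -> K^o) : bounded_linear l ->
  exists2 L : Z -> Y, bounded_linear L & forall x y, L (t x y) = l x *: y.
Proof.
move=> lb; pose b x (y : Y) := l x *: y.
have bl : bilinear_for *:%R *:%R b.
  split=> [y a u v|x a u v]; rewrite /b.
    exact: (bounded_linear_scaler y lb).1.
  by rewrite scalerDr /= !scalerA mulrC.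
pose bM := bilinear_isBilinear.Build K X Y Y *:%R *:%R b bl.
pose b' : {bilinear X -> Y -> Y} := HB.pack b bM.
have [C _ lC] := bounded_linearP lb.
apply: (@tensor_lift _ b' C) => x y.
by rewrite /= /b rnormZ mulrA ler_wpM2r ?rnorm_ge0.
Qed.

Lemma tensor_contractr (l : Y -> K^o) : bounded_linear l ->
  exists2 L : Z -> X, bounded_linear L & forall x y, L (t x y) = l y *: x.
Proof.
move=> lb; pose b (x : X) y := l y *: x.
have bl : bilinear_for *:%R *:%R b.
  split=> [y a u v|x a u v]; rewrite /b.
    by rewrite scalerDr /= !scalerA mulrC.
  exact: (bounded_linear_scaler x lb).1.
pose bM := bilinear_isBilinear.Build K X Y X *:%R *:%R b bl.
pose b' : {bilinear X -> Y -> X} := HB.pack b bM.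
have [C _ lC] := bounded_linearP lb.
apply: (@tensor_lift _ b' C) => x y.
by rewrite /= /b rnormZ (mulrC (rnorm x)) mulrA ler_wpM2r ?rnorm_ge0.
Qed.

Lemma tensor_bounded_linearl y : bounded_linear (t^~ y).
Proof.
split=> [a u v|]; first by rewrite linearPl.
by exists (rnorm y) => x; rewrite mulrC rnorm_tensor.
Qed.

Lemma tensor_bounded_linearr x : bounded_linear (t x).
Proof.
split=> [a u v|]; first by rewrite linearPr.
by exists (rnorm x) => y; rewrite rnorm_tensor.
Qed.

End TensorProduct.

(** * Finite rank operators and Schauder coordinates *)

Section PowerRoot.
Variables (R : realType) (p : R).
Hypothesis p0 : 0 < p.

Lemma powRK (x : R) : 0 <= x -> (x `^ p) `^ p^-1 = x.
Proof. by move=> x0; rewrite -powRrM divff ?gt_eqF// powRr1. Qed.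

Lemma powRVK (x : R) : 0 <= x -> (x `^ p^-1) `^ p = x.
Proof. by move=> x0; rewrite -powRrM mulVf ?gt_eqF// powRr1. Qed.

End PowerRoot.

Section FiniteDimensional.
Variables (R : realType) (k : scalar_kind).
Local Notation K := (scalars R k).
Variable X : normedModType K.

Lemma separating_functional (x : X) : x != 0 ->
  exists2 f : X -> K^o, bounded_linear f & f x = 1.
Proof.
move=> x0; have [r [rl rb rx]] := norming_functional x.
have [|f fb fr] := @real_functional_re R k X r.
  by split=> //; exists 1 => y; rewrite mul1r.
have fx0 : f x != 0.
  apply: contraTneq (rnorm_gt0 x0) => fx0.
  by rewrite -rx -fr fx0 -(rmorph0 scalar_in) scalar_reK ltxx.
exists (fun y => (f x)^-1 *: f y); first exact: bounded_linear_scale.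
exact: mulVf.
Qed.

(** Induction on the number of generators: the coordinate of a new generator
    [u] is read off, by a functional that does not vanish at [u - Q u], from
    what is left of a vector after the projection [Q] on the span of the other
    generators. *)
Lemma span_coordinates n (e : 'I_n -> X) :
  exists2 l : 'I_n -> X -> K^o, (forall i, bounded_linear (l i)) &
    forall a : 'I_n -> K, let x := \sum_i a i *: e i in x = \sum_i l i x *: e i.
Proof.
elim: n e => [|n IH] e.
  by exists (fun _ _ => 0) => [[]//|a /=]; rewrite !big_ord0.
have [l lb lP] := IH (e \o lift ord0).
pose u := e ord0; pose Q x := \sum_i l i x *: e (lift ord0 i).
have Qb : bounded_linear Q.
  by apply: bounded_linear_bigsum => i; exact: bounded_linear_scaler.
have Qid a : Q (\sum_i a i *: e (lift ord0 i)) = \sum_i a i *: e (lift ord0 i).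
  by have := lP a.
have [f fb fP] : exists2 f : X -> K^o, bounded_linear f & forall (b : K) v,
    Q v = v -> Q (b *: u + v - f (b *: u + v) *: u) = b *: u + v - f (b *: u + v) *: u.
  have [uQ|uQ] := eqVneq (u - Q u) 0.
    exists (fun=> 0) => [|b v Qv]; first exact: bounded_linear_cst0.
    rewrite scale0r subr0 Qb.1 Qv; congr (_ *: _ + _).
    by apply/esym/eqP; rewrite -subr_eq0 uQ.
  have [g gb gu] := separating_functional uQ.
  exists (fun x => g (x - Q x)) => [|b v Qv].
    apply: bounded_linear_comp => //; apply: bounded_linear_sub => //.
    exact: bounded_linear_id.
  have -> : g (b *: u + v - Q (b *: u + v)) = b.
    rewrite Qb.1 Qv opprD addrACA subrr addr0 -scalerBr (bounded_linearZ gb) gu.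
    exact: mulr1.
  by rewrite addrAC subrr add0r.
exists (fun i x => if unlift ord0 i is Some j then l j (x - f x *: u) else f x).
  move=> i; case: unlift => [j|//]; apply: bounded_linear_comp => //.
  apply: bounded_linear_sub; first exact: bounded_linear_id.
  exact: bounded_linear_scaler.
move=> a /=; set x := \sum_i _.
rewrite big_ord_recl unlift_none.
under eq_bigr do rewrite liftK.
have := fP (a ord0) (\sum_i a (lift ord0 i) *: e (lift ord0 i)) (Qid _).
have <- : x = a ord0 *: u + \sum_i a (lift ord0 i) *: e (lift ord0 i).
  by rewrite /x big_ord_recl.
by rewrite /Q => ->; rewrite addrC subrK.
Qed.

Lemma finite_dimensional_coordinates (E : set X) : finite_dimensional E ->
  exists n (e : 'I_n -> X) (l : 'I_n -> X -> K^o),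
    (forall i, bounded_linear (l i)) /\ forall x, E x -> x = \sum_i l i x *: e i.
Proof.
move=> [n [e ->]]; have [l lb lP] := span_coordinates e.
by exists n, e, l; split=> // _ [a ->]; exact: lP.
Qed.

End FiniteDimensional.

Section SchauderCoordinates.
Variables (R : realType) (k : scalar_kind).
Local Notation K := (scalars R k).
Variables (X : normedModType K) (I : countType) (D : I -> set X) (p : R).
Hypothesis p1 : 1 < p.
Hypothesis hD : unconditional_schauder_decomposition D.
Hypothesis hDp : disjoint_lower_estimate D p.

Let p0 : 0 < p. Proof. exact: lt_trans ltr01 p1. Qed.

Lemma schauder_proj_decomposes x : decomposes D x (fun i => schauder_proj D i x).
Proof.
have [f [fx _]] := hD.2 x.
by have := @xgetPex _ (fun=> 0) (decomposes D x) (ex_intro _ f fx).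
Qed.

Lemma schauder_proj_uniq x f : decomposes D x f ->
  f = fun i => schauder_proj D i x.
Proof.
move=> fx; have [g [_ gu]] := hD.2 x.
by rewrite -(gu _ fx) -(gu _ (schauder_proj_decomposes x)).
Qed.

Lemma schauder_proj_linear i : linear (schauder_proj D i).
Proof.
move=> a x y.
have [[Dx cx] [Dy cy]] := (schauder_proj_decomposes x, schauder_proj_decomposes y).
suff /schauder_proj_uniq/(congr1 (@^~ i)) :
  decomposes D (a *: x + y) (fun i => a *: schauder_proj D i x + schauder_proj D i y) by [].
split=> [j|]; first by have [_ _] := hD.1 j; apply.
rewrite /unconditional_sum.
have -> : summability.partial_sum
      (fun i => a *: schauder_proj D i x + schauder_proj D i y) =
    (fun A => a *: summability.partial_sum (schauder_proj D ^~ x) A +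
              summability.partial_sum (schauder_proj D ^~ y) A).
  apply/funext => A; rewrite /summability.partial_sum big_split /=; congr (_ + _).
  by rewrite scaler_sumr.
have TF := @summability.totally_filter I.
by apply: cvgD; [apply: cvgZ; [exact: cvg_cst|exact: cx]|exact: cy].
Qed.

(** The coordinates in the order given by the enumeration of [I], with zeros
    at the integers that code no index. *)
Definition coordinate (n : nat) (x : X) : X :=
  if choice.pickle_inv n is Some i then schauder_proj D i x else 0.

Definition segment (m n : nat) : {fset I} :=
  [fset i in pmap (@choice.pickle_inv I) (index_iota m n)]%fset.

Lemma in_segment m n i : (i \in segment m n) = (m <= choice.pickle i < n)%N.
Proof.
rewrite !inE /= -mem_index_iota mem_pmap.
apply/mapP/idP => [[l lmn il]|imn].
  by have := @choice.pickle_invK I l; rewrite -il /= => ->.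
by exists (choice.pickle i) => //; rewrite choice.pickleK_inv.
Qed.

Lemma sum_coordinate m n x :
  \sum_(m <= l < n) coordinate l x = schauder_fproj D (segment m n) x.
Proof.
rewrite /schauder_fproj.
have -> : \sum_(m <= l < n) coordinate l x =
    \sum_(i <- pmap (@choice.pickle_inv I) (index_iota m n)) schauder_proj D i x.
  elim: (index_iota m n) => [|l s IH]; first by rewrite !big_nil.
  rewrite big_cons IH /= /coordinate.
  by case: choice.pickle_inv => [i|] /=; rewrite ?big_cons ?add0r.
apply: perm_big; apply: uniq_perm.
- by apply: (pmap_uniq (@choice.pickle_invK I)); exact: iota_uniq.
- exact: fset_uniq.
- by move=> i; rewrite in_fset.
Qed.

Lemma sum_coordinate_cvg x e : 0 < e -> exists N, forall n, (N <= n)%N ->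
  rnorm (x - \sum_(0 <= l < n) coordinate l x) < e.
Proof.
have TF := @summability.totally_filter I.
move=> e0; have [_ /(@cvg_rnormP _ _ _ _ _ TF)/(_ e e0)[A _ AP]] := schauder_proj_decomposes x.
exists (\max_(i <- A) (choice.pickle i).+1) => n An.
have /AP /= : (A `<=` segment 0 n)%fset.
  apply/fsubsetP => i iA; rewrite in_segment /=; apply: leq_trans An.
  by rewrite (big_rem i) //= leq_maxl.
by rewrite /summability.partial_sum sum_coordinate /schauder_fproj big_seq_fsetE.
Qed.

(** The segments delimited by a nondecreasing sequence are pairwise disjoint, so
    the lower estimate applies to them. *)
Lemma coordinate_estimate : exists2 c : R, 0 < c &
  forall (v : nat -> nat) (N : nat) x, {homo v : i j / (i <= j)%N} ->
    \sum_(0 <= j < N) rnorm (\sum_(v j <= l < v j.+1) coordinate l x) `^ p <=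
      (c * rnorm x) `^ p.
Proof.
have [c c0 cP] := hDp; exists c => // v N x vmono.
have dis (i j : 'I_N) : (i < j)%N ->
    [disjoint segment (v i) (v i.+1) & segment (v j) (v j.+1)]%fset.
  move=> ij; apply/fdisjointP => a; rewrite !in_segment => /andP[_ ai].
  by rewrite negb_and -ltnNge (leq_trans ai)// vmono.
have H := cP N (fun j => segment (v j) (v j.+1)) _ x.
have S0 : 0 <= \sum_(j < N) rnorm (schauder_fproj D (segment (v j) (v j.+1)) x) `^ p.
  by apply: sumr_ge0 => j _; exact: powR_ge0.
rewrite big_mkord; under eq_bigr do rewrite sum_coordinate.
rewrite -[leLHS](powRVK p0) //; apply: ge0_ler_powR; rewrite ?nnegrE ?powR_ge0 ?(ltW p0)//.
  by rewrite mulr_ge0 ?(ltW c0)// rnorm_ge0.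
apply: H => i j; rewrite neq_ltn => /orP[|ji]; first exact: dis.
by rewrite fdisjoint_sym dis.
Qed.

(** The continuity of the coordinates, usually drawn from the closed graph
    theorem, is the lower estimate for a single block. *)
Lemma coordinate_bounded_linear n : bounded_linear (coordinate n).
Proof.
have [c c0 cP] := coordinate_estimate; split=> [a x y|].
  rewrite /coordinate; case: choice.pickle_inv => [i|]; first exact: schauder_proj_linear.
  by rewrite scaler0 addr0.
exists c => x.
have := cP (fun i => i + n)%N 1%N x; rewrite !big_nat1 add0n => H.
have /H {}H : {homo addn^~ n : i j / (i <= j)%N} by move=> i j ij; rewrite leq_add2r.
rewrite -[leLHS](powRK p0) ?rnorm_ge0//.
rewrite -[leRHS](powRK p0) ?mulr_ge0 ?rnorm_ge0 ?(ltW c0)//.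
by apply: ge0_ler_powR; rewrite ?nnegrE ?powR_ge0 // invr_ge0 ltW.
Qed.

Lemma coordinate_finite_rank n : (forall i, finite_dimensional (D i)) ->
  exists m (e : 'I_m -> X) (l : 'I_m -> X -> K^o),
    (forall i, bounded_linear (l i)) /\ forall x, coordinate n x = \sum_i l i x *: e i.
Proof.
move=> Dfin; have cb := coordinate_bounded_linear n; move: cb; rewrite /coordinate.
case: choice.pickle_inv => [i|] cb.
  have [m [e [l [lb lP]]]] := finite_dimensional_coordinates (Dfin i).
  exists m, e, (fun j x => l j (schauder_proj D i x)); split.
    by move=> j; apply: bounded_linear_comp.
  by move=> x; apply: lP; exact: (schauder_proj_decomposes x).1.
exists 0%N, (fun=> 0), (fun _ _ => 0); split=> [[]//|x].
by rewrite big_ord0.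
Qed.

End SchauderCoordinates.

(** * Diagonal blocks of the tensor product *)

Section DiagonalEstimate.
Variables (R : realType) (p q : R).
Hypotheses (p1 : 1 < p) (q1 : 1 < q) (pq : 1 <= p^-1 + q^-1).

Let p0 : 0 < p. Proof. exact: lt_trans ltr01 p1. Qed.
Let q0 : 0 < q. Proof. exact: lt_trans ltr01 q1. Qed.

(** With [m = max (a ^ p, b ^ q) <= 1] one has
    [a b <= m ^ (1 / p + 1 / q) <= m]: the condition on the exponents is what
    replaces the duality of Hoelder's inequality. *)
Lemma mul_le_powR (a b : R) : 0 <= a <= 1 -> 0 <= b <= 1 ->
  a * b <= a `^ p + b `^ q.
Proof.
move=> /andP[a0 a1] /andP[b0 b1].
pose m := Num.max (a `^ p) (b `^ q).
have le1 (x s : R) : 0 <= x <= 1 -> 0 <= s -> x `^ s <= 1.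
  move=> /andP[x0 x1] s0; have <- : (1 : R) `^ s = 1 by rewrite powR1.
  by apply: ge0_ler_powR; rewrite ?nnegrE.
have m0 : 0 <= m by rewrite le_max powR_ge0.
have m1 : m <= 1 by rewrite ge_max !le1 ?a0 ?b0 ?(ltW p0) ?(ltW q0).
have am : a <= m `^ p^-1.
  rewrite -[leLHS](powRK p0) //.
  apply: ge0_ler_powR; rewrite ?nnegrE ?powR_ge0 ?invr_ge0 ?(ltW p0)//.
  by rewrite le_max lexx.
have bm : b <= m `^ q^-1.
  rewrite -[leLHS](powRK q0) //.
  apply: ge0_ler_powR; rewrite ?nnegrE ?powR_ge0 ?invr_ge0 ?(ltW q0)//.
  by rewrite le_max lexx orbT.
apply: le_trans (ler_pM a0 b0 am bm) _.
apply: le_trans (_ : _ <= m) _; last by rewrite ge_max lerDl lerDr !powR_ge0.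
rewrite -powRD; last by rewrite gt_eqF ?implyFb// (lt_le_trans ltr01 pq).
have s1 : 1 + (p^-1 + q^-1 - 1) = p^-1 + q^-1 by rewrite addrC subrK.
rewrite -s1 powRD; last by rewrite s1 gt_eqF // (lt_le_trans ltr01 pq).
by rewrite powRr1 // ler_piMr // le1 ?m0 ?subr_ge0.
Qed.

Lemma sum_mul_le (N : nat) (a b : nat -> R) (A B : R) :
  (forall j, 0 <= a j) -> (forall j, 0 <= b j) -> 0 < A -> 0 < B ->
  \sum_(0 <= j < N) a j `^ p <= A `^ p -> \sum_(0 <= j < N) b j `^ q <= B `^ q ->
  \sum_(0 <= j < N) a j * b j <= 2 * (A * B).
Proof.
have normalize (s : R) (f : nat -> R) (F : R) : 0 < s -> (forall j, 0 <= f j) -> 0 < F ->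
    \sum_(0 <= j < N) f j `^ s <= F `^ s ->
    \sum_(0 <= j < N) (f j / F) `^ s <= 1 /\
    forall j, (j < N)%N -> 0 <= f j / F <= 1.
  move=> s0 f0 F0 fF.
  have fE j : f j `^ s = F `^ s * (f j / F) `^ s.
    by rewrite -powRM ?divr_ge0 ?(ltW F0)// mulrCA divff ?mulr1 // gt_eqF.
  have sum1 : \sum_(0 <= j < N) (f j / F) `^ s <= 1.
    move: fF; under eq_bigr do rewrite fE.
    by rewrite -mulr_sumr ger_pMr // powR_gt0.
  split=> // j jN; rewrite divr_ge0 ?(ltW F0)//=.
  rewrite leNgt; apply/negP => big.
  have : (f j / F) `^ s <= 1.
    apply: le_trans sum1; rewrite big_mkord (bigD1 (Ordinal jN)) //= lerDl.
    by apply: sumr_ge0 => i _; exact: powR_ge0.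
  rewrite leNgt => /negP; apply; have {1}<- : (1 : R) `^ s = 1 by rewrite powR1.
  by apply: gt0_ltr_powR; rewrite ?nnegrE ?divr_ge0 ?(ltW F0).
move=> a0 b0 A0 B0 /(normalize _ _ _ p0 a0 A0)[sa an] /(normalize _ _ _ q0 b0 B0)[sb bn].
have -> : \sum_(0 <= j < N) a j * b j =
    (A * B) * \sum_(0 <= j < N) (a j / A) * (b j / B).
  rewrite mulr_sumr; apply: eq_bigr => j _; rewrite mulrACA.
  by rewrite (mulrC A) (mulrC B) !divfK ?gt_eqF.
rewrite [leRHS]mulrC ler_wpM2l ?mulr_ge0 ?(ltW A0) ?(ltW B0)//.
apply: le_trans (_ : _ <= \sum_(0 <= j < N) ((a j / A) `^ p + (b j / B) `^ q)) _.
  rewrite !big_mkord; apply: ler_sum => j _.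
  by apply: mul_le_powR; [exact: an|exact: bn].
by rewrite big_split /= (_ : 2 = 1 + 1)// lerD.
Qed.

End DiagonalEstimate.

Section ProjectiveTensorSWCG.
Variables (R : realType) (k : scalar_kind).
Local Notation K := (scalars R k).
Variables (X Y Z : completeNormedModType K) (t : {bilinear X -> Y -> Z}).
Hypothesis ht : is_projective_tensor_product t.

Lemma finite_rank_tensorl (A : X -> X) : swcg Y ->
  (exists m (e : 'I_m -> X) (l : 'I_m -> X -> K^o),
    (forall i, bounded_linear (l i)) /\ forall x, A x = \sum_i l i x *: e i) ->
  exists L : Z -> Z, [/\ bounded_linear L, strongly_generated L &
    forall x y, L (t x y) = t (A x) y].
Proof.
move=> hY [m [e [l [lb AE]]]].
have /choice[c cP] i : exists c : Z -> Y, bounded_linear c /\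
    forall x y, c (t x y) = l i x *: y.
  by have [c cb ct] := tensor_contractl ht (lb i); exists c.
exists (fun z => \sum_i t (e i) (c i z)); split.
- apply: bounded_linear_bigsum => i; apply: bounded_linear_comp; last exact: (cP i).1.
  exact: tensor_bounded_linearr.
- apply: strongly_generated_sum => i; apply: strongly_generated_swcg => //.
    exact: (cP i).1.
  exact: tensor_bounded_linearr.
- move=> x y; rewrite AE (bounded_linear_sum _ _ (tensor_bounded_linearl ht y)).
  by apply: eq_bigr => i _; rewrite (cP i).2 linearZr_LR linearZl_LR.
Qed.

Lemma finite_rank_tensorr (B : Y -> Y) : swcg X ->
  (exists m (e : 'I_m -> Y) (l : 'I_m -> Y -> K^o),
    (forall i, bounded_linear (l i)) /\ forall y, B y = \sum_i l i y *: e i) ->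
  exists L : Z -> Z, [/\ bounded_linear L, strongly_generated L &
    forall x y, L (t x y) = t x (B y)].
Proof.
move=> hX [m [e [l [lb BE]]]].
have /choice[c cP] i : exists c : Z -> X, bounded_linear c /\
    forall x y, c (t x y) = l i y *: x.
  by have [c cb ct] := tensor_contractr ht (lb i); exists c.
exists (fun z => \sum_i t (c i z) (e i)); split.
- apply: bounded_linear_bigsum => i.
  apply: (bounded_linear_comp (tensor_bounded_linearl ht (e i))); exact: (cP i).1.
- apply: strongly_generated_sum => i.
  apply: (strongly_generated_swcg hX (cP i).1 (tensor_bounded_linearl ht (e i))).
- move=> x y; rewrite BE (bounded_linear_sum _ _ (tensor_bounded_linearr ht x)).
  by apply: eq_bigr => i _; rewrite (cP i).2 linearZr_LR linearZl_LR.
Qed.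

Variables (u : nat -> X -> X) (v : nat -> Y -> Y).
Hypotheses (ub : forall n, bounded_linear (u n)) (vb : forall n, bounded_linear (v n)).
Hypothesis ucvg : forall x (e : R), 0 < e -> exists N, forall n, (N <= n)%N ->
  rnorm (x - \sum_(0 <= l < n) u l x) < e.
Hypothesis vcvg : forall y (e : R), 0 < e -> exists N, forall n, (N <= n)%N ->
  rnorm (y - \sum_(0 <= l < n) v l y) < e.
Variable C : R.
Hypothesis C0 : 0 <= C.
Hypothesis uvC : forall (w : nat -> nat) (N : nat) x y,
  {homo w : i j / (i <= j)%N} ->
  \sum_(0 <= j < N) rnorm (\sum_(w j <= l < w j.+1) u l x) *
                    rnorm (\sum_(w j <= l < w j.+1) v l y) <=
    C * (rnorm x * rnorm y).

Lemma tensor_diff x y x' y' :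
  t x y - t (x - x') (y - y') = t x' y + t (x - x') y'.
Proof.
rewrite (bounded_linearB (tensor_bounded_linearr ht (x - x'))).
rewrite (bounded_linearB (tensor_bounded_linearl ht y)) !opprB addrCA.
by rewrite [_ + (_ - t x y)]addrC subrK addrC.
Qed.

Lemma tensor_block : exists Q : nat -> nat -> Z -> Z,
  (forall m n, bounded_linear (Q m n)) /\ forall m n x y,
    Q m n (t x y) = t (\sum_(m <= l < n) u l x) (\sum_(m <= l < n) v l y).
Proof.
have /choice[Q QP] (mn : nat * nat) : exists L : Z -> Z, bounded_linear L /\
    forall x y, L (t x y) = t (\sum_(mn.1 <= l < mn.2) u l x) (\sum_(mn.1 <= l < mn.2) v l y).
  have Ab := bounded_linear_bigsum (index_iota mn.1 mn.2) ub.
  have Bb := bounded_linear_bigsum (index_iota mn.1 mn.2) vb.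
  have [L Lb Lt] := tensor_map_bilinear ht Ab Bb.
  by exists L.
by exists (fun m n => Q (m, n)); split=> [m n|m n x y]; [exact: (QP _).1|exact: (QP _).2].
Qed.

Lemma tensor_rest : exists Q : nat -> Z -> Z,
  (forall n, bounded_linear (Q n)) /\ forall n x y,
    Q n (t x y) = t (x - \sum_(0 <= l < n) u l x) (y - \sum_(0 <= l < n) v l y).
Proof.
have /choice[Q QP] (n : nat) : exists L : Z -> Z, bounded_linear L /\
    forall x y, L (t x y) = t (x - \sum_(0 <= l < n) u l x) (y - \sum_(0 <= l < n) v l y).
  have Ab := bounded_linear_sub (bounded_linear_id X)
    (bounded_linear_bigsum (index_iota 0 n) ub).
  have Bb := bounded_linear_sub (bounded_linear_id Y)
    (bounded_linear_bigsum (index_iota 0 n) vb).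
  have [L Lb Lt] := tensor_map_bilinear ht Ab Bb.
  by exists L.
by exists Q; split=> [n|n x y]; [exact: (QP _).1|exact: (QP _).2].
Qed.

Section Rest.
Variables (Q : nat -> nat -> Z -> Z) (S : nat -> Z -> Z).
Hypotheses (Qb : forall m n, bounded_linear (Q m n)) (Sb : forall n, bounded_linear (S n)).
Hypothesis Qt : forall m n x y,
  Q m n (t x y) = t (\sum_(m <= l < n) u l x) (\sum_(m <= l < n) v l y).
Hypothesis St : forall n x y,
  S n (t x y) = t (x - \sum_(0 <= l < n) u l x) (y - \sum_(0 <= l < n) v l y).

(** The pinching of [Z] on diagonal blocks is bounded into an l1-sum: the
    projective norm reduces this to elementary tensors. *)
Lemma diagonal_blocks_bound (w : nat -> nat) (N : nat) z :
  {homo w : i j / (i <= j)%N} ->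
  \sum_(0 <= j < N) rnorm (Q (w j) (w j.+1) z) <= C * rnorm z.
Proof.
move=> wmono.
have [M MP] : exists M : R, forall z,
    \sum_(0 <= j < N) rnorm (Q (w j) (w j.+1) z) <= M * rnorm z.
  elim: N => [|N [M MP]]; first by exists 0 => z'; rewrite big_geq // mul0r.
  have [D _ QD] := bounded_linearP (Qb (w N) (w N.+1)).
  by exists (M + D) => z'; rewrite big_nat_recr //= mulrDl lerD.
apply: (@tensor_bound _ _ _ _ _ _ ht
  (fun z => \sum_(0 <= j < N) rnorm (Q (w j) (w j.+1) z)) C M) => //.
- by rewrite big1 // => j _; rewrite (bounded_linear0 (Qb _ _)) rnorm0.
- move=> z1 z2; rewrite -big_split; apply: ler_sum => j _.
  by rewrite (bounded_linearD (Qb _ _)) rnormD.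
- move=> x y; apply: le_trans (uvC N x y wmono); apply: ler_sum => j _.
  by rewrite Qt (rnorm_tensor ht).
Qed.

(** The square block on [[n, m)] exhausts, as [m] grows, the part of [z] that lies
    beyond rank [n] in both factors. *)
Lemma rest_approx n z e : 0 < e ->
  exists N, forall m, (N <= m)%N -> rnorm (S n z - Q n m z) < e.
Proof.
move: z e; apply: (tensor_ind ht).
- move=> e e0; exists 0%N => m _.
  by rewrite (bounded_linear0 (Sb _)) (bounded_linear0 (Qb _ _)) subrr rnorm0.
- move=> z1 z2 h1 h2 e e0; have e2 : 0 < e / 2 by rewrite divr_gt0.
  have [[N1 P1] [N2 P2]] := (h1 _ e2, h2 _ e2); exists (maxn N1 N2) => m.
  rewrite geq_max => /andP[m1 m2].
  rewrite (bounded_linearD (Sb _)) (bounded_linearD (Qb _ _)) opprD addrACA.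
  by apply: le_lt_trans (rnormD _ _) _; rewrite (splitr e) ltrD ?P1 ?P2.
- move=> x y e e0.
  pose x' := x - \sum_(0 <= l < n) u l x; pose y' := y - \sum_(0 <= l < n) v l y.
  pose B := rnorm x' + rnorm y' + 1.
  have B0 : 0 < B by rewrite ltr_wpDl // addr_ge0 ?rnorm_ge0.
  pose d := Num.min 1 (e / 2 / B).
  have d0 : 0 < d by rewrite lt_min ltr01 !divr_gt0.
  have d1 : d <= 1 by rewrite ge_min lexx.
  have dB : d * B <= e / 2 by rewrite -ler_pdivlMr // ge_min lexx orbT.
  have [[N1 P1] [N2 P2]] := (ucvg x d0, vcvg y d0).
  exists (maxn n (maxn N1 N2)) => m; rewrite !geq_max => /and3P[nm m1 m2].
  have restE (W : normedModType K) (f : nat -> W) (a : W) :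
      \sum_(n <= l < m) f l = a - \sum_(0 <= l < n) f l - (a - \sum_(0 <= l < m) f l).
    by rewrite (@big_cat_nat _ _ _ n 0 m)//= !opprD opprK addrACA subrr add0r
      opprK addrA addNr add0r.
  rewrite St Qt (restE _ _ x) (restE _ _ y) -/x' -/y'.
  set x'' := x - _; set y'' := y - _.
  rewrite tensor_diff.
  have [x''d y''d] : rnorm x'' <= d /\ rnorm y'' <= d by rewrite !ltW ?P1 ?P2.
  apply: le_lt_trans (_ : _ <= d * B) _; last first.
    by apply: le_lt_trans dB _; rewrite ltr_pdivrMr // ltr_pMr // ltr1n.
  have h1 : rnorm (t x'' y') <= d * rnorm y'.
    by apply: le_trans (rnorm_tensor ht _ _) _; rewrite ler_wpM2r ?rnorm_ge0.
  have h2 : rnorm (t (x' - x'') y'') <= d * (rnorm x' + 1).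
    apply: le_trans (rnorm_tensor ht _ _) _; rewrite mulrC ler_pM ?rnorm_ge0//.
    by rewrite (le_trans (rnormB _ _))// lerD2l (le_trans x''d).
  apply: le_trans (rnormD _ _) (le_trans (lerD h1 h2) _).
  by rewrite -mulrDr /B addrCA addrA.
- move=> z happ e e0; have [D D0 SD] := bounded_linearP (Sb n).
  have e2 : 0 < e / 2 by rewrite divr_gt0.
  have DC : 0 < D + C by rewrite ltr_pwDl.
  have QC m z' : (n <= m)%N -> rnorm (Q n m z') <= C * rnorm z'.
    move=> nm; have := @diagonal_blocks_bound (fun i => if i is 0%N then n else m) 1 z'.
    by rewrite big_nat1; apply; case=> [|i] [|j].
  have [z' Pz' zz'] := happ _ (divr_gt0 e2 DC); have [N NP] := Pz' _ e2.
  exists (maxn n N) => m; rewrite geq_max => /andP[nm Nm].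
  have -> : S n z - Q n m z = (S n z' - Q n m z') + (S n (z - z') - Q n m (z - z')).
    rewrite (bounded_linearB (Sb n)) (bounded_linearB (Qb n m)) opprB addrACA addKr.
    by rewrite [S n z' + _]addrC subrK.
  apply: le_lt_trans (rnormD _ _) _; rewrite (splitr e) ltr_leD ?NP//.
  apply: le_trans (rnormB _ _) _; apply: le_trans (lerD (SD _) (QC _ _ nm)) _.
  by rewrite -mulrDl mulrC -ler_pdivlMr // ltW.
Qed.


(** Otherwise there are elements [T j] of [A] and consecutive blocks such that the
    [j]-th diagonal block of [T j] has norm more than [e].  Norming functionals of
    these blocks give, by [diagonal_blocks_bound], a summable sequence of
    functionals that is large on the diagonal. *)
Lemma rest_uniformly_small (A : set Z) (e : R) : weakly_compact A -> 0 < e ->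
  exists n, forall z, A z -> rnorm (S n z) <= e.
Proof.
move=> Ac e0; apply: contrapT => /forallNP bad.
have /choice[zm zmP] n : exists zm : Z * nat,
    [/\ A zm.1, (n <= zm.2)%N & e < rnorm (Q n zm.2 zm.1)].
  have /existsNP[z /not_implyP[Az /negP]] := bad n; rewrite -ltNge => Sz.
  have d0 : 0 < rnorm (S n z) - e by rewrite subr_gt0.
  have [N NP] := rest_approx n z d0.
  exists (z, maxn n N); split=> //=; first exact: leq_maxl.
  have := NP _ (leq_maxr n N); have := rnormB (Q n (maxn n N) z - S n z) (- S n z).
  rewrite opprK subrK rnormN rdistC.
  have := rnorm_triangle (S n z) (Q n (maxn n N) z) 0; rewrite !subr0.
  by lra.
pose w j := iter j (fun n => (zm n).2) 0%N.
have wmono : {homo w : i j / (i <= j)%N}.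
  by apply: homo_leq => // [i j l|i]; [exact: leq_trans|have [] := zmP (w i)].
pose T j := (zm (w j)).1.
have QT j : e < rnorm (Q (w j) (w j.+1) (T j)) by have [] := zmP (w j).
have /choice[r rP] j := norming_functional (Q (w j) (w j.+1) (T j)).
pose a j z := r j (Q (w j) (w j.+1) z).
have [] := @summable_functionals_diagonal R k Z A a C T e.
- exact: Ac.
- move=> j; have [rl rb _] := rP j.
  have rf : real_functional (r j) by split=> //; exists 1 => y; rewrite mul1r.
  exact: (real_functional_comp rf (Qb _ _)).1.
- move=> z n; apply: le_trans (diagonal_blocks_bound n z wmono).
  by apply: ler_sum => j _; have [_ rb _] := rP j; exact: rb.
- by move=> j; have [] := zmP (w j).
- exact: e0.
- move=> j; apply/negP; rewrite -leNgt /a; have [_ _ ->] := rP j.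
  by rewrite ger0_norm ?rnorm_ge0 // ltW.
Qed.

End Rest.
End ProjectiveTensorSWCG.

(** * The theorem *)

Theorem theorem1p1 (R : realType) (k : scalar_kind) (p q : R)
    (hp : 1 < p) (hq : 1 < q) (hpq : 1 <= p^-1 + q^-1)
    (X Y : completeNormedModType (scalars R k)) (I J : countType)
    (D : I -> set X) (E : J -> set Y)
    (hD : unconditional_schauder_decomposition D)
    (hDfin : forall i, finite_dimensional (D i))
    (hDp : disjoint_lower_estimate D p)
    (hE : unconditional_schauder_decomposition E)
    (hEfin : forall j, finite_dimensional (E j))
    (hEq : disjoint_lower_estimate E q)
    (hX : swcg X) (hY : swcg Y)
    (Z : completeNormedModType (scalars R k)) (t : {bilinear X -> Y -> Z})
    (ht : is_projective_tensor_product t) :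
  swcg Z.
Proof.
pose u := coordinate D; pose v := coordinate E.
have ub n : bounded_linear (u n) by exact: (coordinate_bounded_linear hp hD hDp).
have vb n : bounded_linear (v n) by exact: (coordinate_bounded_linear hq hE hEq).
have [c c0 uc] := coordinate_estimate hp hDp.
have [d d0 vd] := coordinate_estimate hq hEq.
have C0 : 0 <= 2 * (c * d) by rewrite mulr_ge0 // mulr_ge0 ?(ltW c0) ?(ltW d0).
have uvC (w : nat -> nat) (N : nat) x y : {homo w : i j / (i <= j)%N} ->
    \sum_(0 <= j < N) rnorm (\sum_(w j <= l < w j.+1) u l x) *
                      rnorm (\sum_(w j <= l < w j.+1) v l y) <=
      2 * (c * d) * (rnorm x * rnorm y).
  move=> wmono.
  have zero (V : normedModType (scalars R k)) (f : nat -> V -> V) m n :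
      (forall l, bounded_linear (f l)) -> rnorm (\sum_(m <= l < n) f l 0) = 0.
    by move=> fb; rewrite big1 ?rnorm0 // => l _; rewrite (bounded_linear0 (fb l)).
  have [->|x0] := eqVneq x 0.
    rewrite rnorm0 mul0r mulr0 big1 ?lexx // => j _. by rewrite (zero X u _ _ ub) mul0r.
  have [->|y0] := eqVneq y 0.
    by rewrite rnorm0 !mulr0 big1 // => j _; rewrite (zero Y v _ _ vb) mulr0.
  rewrite -mulrA mulrACA.
  apply: (sum_mul_le hp hq hpq) => [j|j|||/=|/=]; rewrite ?rnorm_ge0 //.
  - by rewrite mulr_gt0 // rnorm_gt0.
  - by rewrite mulr_gt0 // rnorm_gt0.
  - exact: uc.
  - exact: vd.
have [Q [Qb Qt]] := tensor_block ht ub vb.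
have [S [Sb St]] := tensor_rest ht ub vb.
have small (A : set Z) (e : R) : weakly_compact A -> 0 < e ->
    exists n, forall z, A z -> rnorm (S n z) <= e.
  apply: (rest_uniformly_small ht _ _ C0 uvC Qb Sb Qt St) => x d' d'0.
    exact: sum_coordinate_cvg.
  exact: sum_coordinate_cvg.
have /choice[U UP] l : exists L : Z -> Z, [/\ bounded_linear L, strongly_generated L &
    forall x y, L (t x y) = t (u l x) y].
  by apply: (finite_rank_tensorl ht hY); exact: (coordinate_finite_rank hp hD hDp).
have /choice[V VP] l : exists L : Z -> Z, [/\ bounded_linear L, strongly_generated L &
    forall x y, L (t x y) = t x (v l y)].
  by apply: (finite_rank_tensorr ht hX); exact: (coordinate_finite_rank hq hE hEq).
pose US n z := \sum_(0 <= l < n) U l z; pose VS n z := \sum_(0 <= l < n) V l z.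
have Ub n : bounded_linear (US n) by apply: bounded_linear_bigsum => l; case: (UP l).
have Vb n : bounded_linear (VS n) by apply: bounded_linear_bigsum => l; case: (VP l).
have Ut n x y : US n (t x y) = t (\sum_(0 <= l < n) u l x) y.
  rewrite (bounded_linear_sum _ _ (tensor_bounded_linearl ht y)).
  by apply: eq_bigr => l _; case: (UP l).
have Vt n x y : VS n (t x y) = t x (\sum_(0 <= l < n) v l y).
  rewrite (bounded_linear_sum _ _ (tensor_bounded_linearr ht x)).
  by apply: eq_bigr => l _; case: (VP l).
have UVb n := bounded_linear_sub (bounded_linear_id Z) (Ub n).
have sg n : strongly_generated (fun z => US n z + VS n (z - US n z)).
  apply: strongly_generatedD.
    by apply: strongly_generated_sum => l; case: (UP l).
  apply: (strongly_generated_comp _ (UVb n)).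
  by apply: strongly_generated_sum => l; case: (VP l).
(* On x (x) y, what remains is (x - P_n x) (x) (y - Q_n y). *)
have SE n z : z - (US n z + VS n (z - US n z)) = S n z.
  apply: (@tensor_ext _ _ _ _ _ _ ht _ (fun z => z - (US n z + VS n (z - US n z)))) => //.
    apply: bounded_linear_sub; first exact: bounded_linear_id.
    by apply: bounded_linear_add => //; exact: (bounded_linear_comp (Vb n) (UVb n)).
  move=> x y; rewrite St (bounded_linearB (Vb n)) Ut !Vt opprD addrA.
  by rewrite (bounded_linearB (tensor_bounded_linearr ht _))
    !(bounded_linearB (tensor_bounded_linearl ht _)).
apply: swcg_strongly_generated; apply: (strongly_generated_approx sg) => A Ac e e0.
have [n nP] := small A e Ac e0; exists n => z Az.
by rewrite SE; exact: nP.
Qed.
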